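(* Let $a,b>0$, let $\Delta_1$ be the Hodge-Laplace operator on $1$-forms of the Berger sphere $(\mathrm{SU}(2),g_{(a,b,b)})$, and fix an integer $k\ge2$. Let $\Delta_1^{(k)}$ be the induced operator on $V_k\otimes\mathfrak{su}(2)_{\mathbb C}^*$ (see context). Define, with the convention $P_l=0$ if $l<0$ or $l>k$, the following elements of $V_k\otimes \mathfrak{su}(2)_{\mathbb C}^*$. For $0\le j\le k$, $$v_{k,j}= j\tfrac{b}{a}\mathrm i\,P_{j-1}\otimes(X_2^*+\mathrm iX_3^* )+(k-2j)P_j\otimes X_1^*-(k-j)\tfrac ba\mathrm i\,P_{j+1}\otimes(X_2^*-\mathrm iX_3^* );$$ $$w_{k,-1}=P_0\otimes(X_2^*-\mathrm iX_3^* ),\qquad w_{k,0}=2\tfrac ba P_0\otimes X_1^*+\mathrm ik\,P_1\otimes(X_2^*-\mathrm iX_3^* ),$$ $$w_{k,k+1}=P_k\otimes(X_2^*+\mathrm iX_3^* ),\qquad w_{k,k}=\mathrm ik\,P_{k-1}\otimes(X_2^*+\mathrm iX_3^* )+2\tfrac ba P_k\otimes X_1^*;$$ and for $1\le j\le k-1$, $$w_{k,j}^\pm=\mathrm i\alpha_j^\pm P_{j-1}\otimes(X_2^*+\mathrm iX_3^* )+\beta_j^\pm P_j\otimes X_1^*+\mathrm i\gamma_j^\pm P_{j+1}\otimes(X_2^*-\mathrm iX_3^* ),$$ where, with $S_j=\sqrt{a^4(k-2j)^2+a^2b^2(2k+4j(k-j))+b^4}$, $$\alpha_j^\pm=\frac{2(k-2j)^2a^2+(2k+4j(k-j))b^2\mp2(k-2j)S_j}{4(k-j+1)b^2},\quad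 \beta_j^\pm=\frac{-a^2(k-2j)+b^2\pm S_j}{ab},\quad \gamma_j^\pm=k-j.$$ Then $$\{v_{k,j}:0\le j\le k\}\cup\{w_{k,-1},w_{k,0},w_{k,k},w_{k,k+1}\}\cup\{w_{k,j}^\pm:1\le j\le k-1\}$$ is a basis of $V_k\otimes\mathfrak{su}(2)^*_{\mathbb C}$ consisting of eigenvectors of $\Delta_1^{(k)}$, and for all indices $j$ occurring in this basis $$\Delta_1^{(k)}v_{k,j}=\nu_{k,j}v_{k,j},\qquad \Delta_1^{(k)}w_{k,j}=\mu_{k,j}w_{k,j},\qquad \Delta_1^{(k)}w_{k,j}^\pm=\mu_{k,j}^\pm w_{k,j}^\pm,$$ where $$\nu_{k,j}=a^2(k-2j)^2+b^2\big((4j+2)k-4j^2\big),\qquad \mu_{k,-1}=\mu_{k,k+1}=(k+2)^2a^2,$$ $$\mu_{k,0}=\mu_{k,k}=k^2a^2+4kb^2+4\tfrac{b^4}{a^2},\qquad \mu_{k,j}^\pm=\nu_{k,j}+2\tfrac{b^4}{a^2}\pm2\tfrac{b^2}{a^2}\sqrt{a^2\nu_{k,j}+b^4}.$$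
   Context: Basis of $\mathfrak{su}(2)$: $E_1=\begin{pmatrix}\mathrm i&0\\0&-\mathrm i\end{pmatrix}$, $E_2=\begin{pmatrix}0&1\\-1&0\end{pmatrix}$, $E_3=\begin{pmatrix}0&\mathrm i\\\mathrm i&0\end{pmatrix}$, with $[E_1,E_2]=2E_3$, $[E_2,E_3]=2E_1$, $[E_3,E_1]=2E_2$. For $a,b,c>0$, $g_{(a,b,c)}$ is the left-invariant metric on $\mathrm{SU}(2)$ for which $X_1=aE_1,X_2=bE_2,X_3=cE_3$ is orthonormal; $\{X_1^*,X_2^*,X_3^*\}$ is the dual basis of $\mathfrak{su}(2)^*$. Here $c=b$. $\Delta_1=d\delta+\delta d$ acts on complex-valued $1$-forms, identified with smooth functions $\mathrm{SU}(2)\to\mathfrak{su}(2)_{\mathbb C}^*$ via the left-invariant trivialization. Representations: $(\varrho_k,V_k)$ is the $(k+1)$-dimensional irreducible representation of $\mathrm{SU}(2)$, on homogeneous polynomials of degree $k$ in two variables, with basis $P_l(z,w)=z^lw^{k-l}$, $0\le l\le k$, and $d\varrho_k(E_1)P_l=(k-2l)\mathrm i\,P_l$, $d\varrho_k(E_2)P_l=-l\,P_{l-1}+(k-l)P_{l+1}$, $d\varrho_k(E_3)P_l=-l\mathrm i\,P_{l-1}-(k-l)\mathrm i\,P_{l+1}$. The operator $\Delta_1^{(k)}$: for $v\in V_k$ and $L\in\mathrm{Hom}(V_k,\mathfrak{su}(2)^*_{\mathbb C})$ let $\omega_{v\otimes L}(x)=L(\varrho_k(x^{-1})v)$. Since $\Delta_1$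 commutes with left translations, there is a unique linear operator $\Delta_1^{(k)}$ on $\mathrm{Hom}(V_k,\mathfrak{su}(2)^*_{\mathbb C})\cong V_k^*\otimes\mathfrak{su}(2)_{\mathbb C}^*$ with $\Delta_1\omega_{v\otimes L}=\omega_{v\otimes\Delta_1^{(k)}L}$ for all $v,L$. It is transported to $V_k\otimes\mathfrak{su}(2)_{\mathbb C}^*$ via an $\mathrm{SU}(2)$-equivariant isomorphism $V_k\cong V_k^*$ (unique up to scalar, so the result does not depend on the choice). *)

(* Defs.v *)
From HB Require Import structures.
From mathcomp Require Import all_boot all_order all_algebra.
From mathcomp Require Import complex ring lra.
From mathcomp Require Import all_classical all_reals all_analysis.
(* The notations of mpoly and of MathComp-Analysis cannot be loaded together. *)
From mathcomp Require mpoly.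
Import -(notations) mpoly.

Set Implicit Arguments.
Unset Strict Implicit.
Unset Printing Implicit Defensive.

Import Order.TTheory GRing.Theory Num.Theory.
Import numFieldNormedType.Exports.
Local Open Scope classical_set_scope.
Local Open Scope sesquilinear_scope.
Local Open Scope complex_scope.
Local Open Scope ring_scope.

(** * The Lie algebra su(2) *)

Definition is_su2 (R : realType) (X : 'M[R[i]]_2) : bool :=
  (X ^t* == - X) && (\tr X == 0).

Record su2 (R : realType) :=
  Su2 { su2_mx :> 'M[R[i]]_2; su2_mxP : is_su2 su2_mx }.

Definition mx2 (T : Type) (x y z t : T) : 'M[T]_2 :=
  \matrix_(i, j) if i == 0 then (if j == 0 then x else y)
                 else (if j == 0 then z else t).

Lemma mx2_eqP (T : Type) (A B : 'M[T]_2) :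
  A 0 0 = B 0 0 -> A 0 1 = B 0 1 -> A 1 0 = B 1 0 -> A 1 1 = B 1 1 -> A = B.
Proof.
move=> h00 h01 h10 h11; apply/matrixP => i j.
have ord2 (x : 'I_2) : x = 0 \/ x = 1.
  by case: x => [[|[|x]] hx] //; [left|right]; apply/val_inj.
by case: (ord2 i) => ->; case: (ord2 j) => ->.
Qed.

Definition Emx (R : realType) (i : 'I_3) : 'M[R[i]]_2 :=
  tnth [tuple mx2 'i 0 0 (- 'i); mx2 0 1 (-1) 0; mx2 0 'i 'i 0] i.

Lemma Emx_su2 (R : realType) (i : 'I_3) : is_su2 (Emx R i).
Proof.
apply/andP; split; apply/eqP.
  apply: mx2_eqP; case: i => [[|[|[|i]]] hi] //;
  rewrite /Emx (tnth_nth 0) /= !mxE /= ?oppr0 ?opprK;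
  apply/eqP; rewrite eq_complex /= ?oppr0 ?opprK ?eqxx //.
by case: i => [[|[|[|i]]] hi] //;
  rewrite /Emx (tnth_nth 0) /= /mxtrace big_ord_recl big_ord1 !mxE /= ?addr0 ?addrN.
Qed.

Definition E (R : realType) (i : 'I_3) : su2 R := Su2 (Emx_su2 R i).

Lemma su2_scale_subproof (R : realType) (t : R) (X : su2 R) : is_su2 (t%:C *: su2_mx X).
Proof.
case: X => X /= /andP[/eqP hX /eqP tX]; apply/andP; split; last first.
  by rewrite mxtraceZ tX mulr0.
rewrite -scalerN -hX; apply/eqP/matrixP => i j; rewrite !mxE rmorphM /=.
by congr (_ * _); exact: conjc_real.
Qed.

Definition su2_scale (R : realType) (t : R) (X : su2 R) : su2 R :=
  Su2 (su2_scale_subproof t X).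

Lemma su2_bracket_subproof (R : realType) (X Y : su2 R) :
  is_su2 (su2_mx X *m su2_mx Y - su2_mx Y *m su2_mx X).
Proof.
case: X => X /= /andP[/eqP hX _]; case: Y => Y /= /andP[/eqP hY _].
apply/andP; split; last by rewrite linearB /= mxtrace_mulC subrr.
rewrite linearB /= map_mxB !trmx_mul !map_mxM hX hY.
by rewrite !mulmxN !mulNmx !opprK opprB.
Qed.

Definition su2_bracket (R : realType) (X Y : su2 R) : su2 R :=
  Su2 (su2_bracket_subproof X Y).

(* Coordinates in the basis E: a matrix of su(2) is uniquely of the form
   x0 E_1 + x1 E_2 + x2 E_3 = [[x0 i, x1 + x2 i], [- x1 + x2 i, - x0 i]]. *)
Definition dualE (R : realType) (i : 'I_3) (X : su2 R) : R :=
  tnth [tuple complex.Im (X 0 0); complex.Re (X 0 1); complex.Im (X 0 1)] i.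

(* The parameters (a, b, c) of the metric; indices of bases start at 0, so that
   X_1, X_2, X_3 are [frame a b c i] for i = 0, 1, 2. *)
Definition par (R : realType) (a b c : R) (i : 'I_3) : R := tnth [tuple a; b; c] i.

Definition frame (R : realType) (a b c : R) (i : 'I_3) : su2 R :=
  su2_scale (par a b c i) (E R i).

Definition dual_frame (R : realType) (a b c : R) (i : 'I_3) (Y : su2 R) : R :=
  dualE i Y / par a b c i.

Lemma dual_frameE (R : realType) (a b c : R) (i j : 'I_3) :
  a != 0 -> b != 0 -> c != 0 ->
  dual_frame a b c i (frame a b c j) = (i == j)%:R.
Proof.
move=> a0 b0 c0; rewrite /dual_frame /dualE /par.
case: i => [[|[|[|i]]] hi] //; case: j => [[|[|[|j]]] hj] //;
  rewrite /su2_scale /= /Emx /par !(tnth_nth 0) /= !mxE /=;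
  rewrite ?(tnth_nth 0) /= ?mxE /=; field.
all: by rewrite ?a0 ?b0 ?c0.
Qed.

Lemma su2_entries (R : realType) (Y : su2 R) :
  su2_mx Y = mx2 (0 +i* complex.Im (Y 0 0))
                 (complex.Re (Y 0 1) +i* complex.Im (Y 0 1))
                 (- complex.Re (Y 0 1) +i* complex.Im (Y 0 1))
                 (0 -i* complex.Im (Y 0 0)).
Proof.
case: Y => Y /= /andP[/eqP hY /eqP tY].
have h00 := congr1 (fun M : 'M[R[i]]_2 => M 0 0) hY.
have h10 := congr1 (fun M : 'M[R[i]]_2 => M 1 0) hY.
move: tY h00 h10; rewrite /mxtrace big_ord_recl big_ord1 !mxE /=.
rewrite (_ : lift ord0 ord0 = 1 :> 'I_2); last exact/val_inj.
move=> tY h00 h10.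
have tR := congr1 (@complex.Re R) tY; have tI := congr1 (@complex.Im R) tY.
have hR := congr1 (@complex.Re R) h00.
have gR := congr1 (@complex.Re R) h10; have gI := congr1 (@complex.Im R) h10.
apply: mx2_eqP; rewrite !mxE /=; move: tR tI hR gR gI.
all: case: (Y 0 0) => x0 y0; case: (Y 0 1) => x1 y1.
all: case: (Y 1 0) => x2 y2; case: (Y 1 1) => x3 y3 /= tR tI hR gR gI.
all: by congr Complex; lra.
Qed.

Lemma dual_frame_sum (R : realType) (a b c : R) (Y : su2 R) :
  a != 0 -> b != 0 -> c != 0 ->
  su2_mx Y = \sum_i (dual_frame a b c i Y)%:C *: su2_mx (frame a b c i).
Proof.
move=> a0 b0 c0.
rewrite (eq_bigr (fun i => (dualE i Y)%:C *: Emx R i)); last first.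
  move=> i _; rewrite /frame /su2_scale /E; cbn [su2_mx].
  rewrite scalerA -rmorphM /= /dual_frame divfK //.
  by case: i => [[|[|[|i]]] hi].
rewrite 3!big_ord_recl big_ord0 addr0 {1}(su2_entries Y) /dualE /Emx.
move: (complex.Im (Y 0 0)) (complex.Re (Y 0 1)) (complex.Im (Y 0 1)) => x y z.
rewrite !(tnth_nth 0) /=.
by apply: mx2_eqP; rewrite !mxE /=; congr Complex; ring.
Qed.

(** * The group SU(2) *)

Definition is_SU2 (R : realType) (x : 'M[R[i]]_2) : bool :=
  (x \is unitarymx) && (\det x == 1).

Record SU2 (R : realType) :=
  MkSU2 { SU2_mx :> 'M[R[i]]_2; SU2_mxP : is_SU2 SU2_mx }.

Lemma SU2_mul_subproof (R : realType) (x y : SU2 R) :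
  is_SU2 (SU2_mx x *m SU2_mx y).
Proof.
case: x => x /= /andP[ux /eqP dx]; case: y => y /= /andP[uy /eqP dy].
by apply/andP; split; [exact: mul_unitarymx | rewrite det_mulmx dx dy mulr1].
Qed.

Definition SU2_mul (R : realType) (x y : SU2 R) : SU2 R :=
  MkSU2 (SU2_mul_subproof x y).

Lemma SU2_inv_subproof (R : realType) (x : SU2 R) : is_SU2 (invmx (SU2_mx x)).
Proof.
case: x => x /= /andP[ux /eqP dx]; apply/andP; split; last first.
  by rewrite det_inv dx invr1.
apply/unitarymxP; rewrite invmx_unitary // trmxCK.
by rewrite -invmx_unitary // mulVmx // unitarymx_unit.
Qed.

Definition SU2_inv (R : realType) (x : SU2 R) : SU2 R :=
  MkSU2 (SU2_inv_subproof x).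

Definition mxexp_sum (R : realType) (A : 'M[R[i]]_2) (N : nat) : 'M[R[i]]_2 :=
  \sum_(0 <= n < N) (n`!%:R)^-1 *: A ^+ n.

(* The limit is taken separately in the real and the imaginary part of every
   entry. *)
Definition mxexp (R : realType) (A : 'M[R[i]]_2) : 'M[R[i]]_2 :=
  \matrix_(i, j)
    (lim ((fun N => complex.Re (mxexp_sum A N i j)) @ \oo)
     +i* lim ((fun N => complex.Im (mxexp_sum A N i j)) @ \oo)).

Lemma expU (R : realType) (U : 'M[R[i]]_2) n : U * U = - 1 ->
  U ^+ n = (if odd n then ((-1) ^+ n./2 : R)%:C *: U
                       else ((-1) ^+ n./2 : R)%:C%:M).
Proof.
move=> U2.
have even m : U ^+ m.*2 = ((-1) ^+ m : R)%:C%:M.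
  rewrite -mul2n exprM expr2 U2 !rmorphXn /=.
  by rewrite !rmorphN /= !rmorph1.
rewrite -{1}(odd_double_half n); case: (odd n); last by rewrite even.
by rewrite exprS even -mulmxE mul_mx_scalar.
Qed.
Lemma mxexp_sum_rot (R : realType) (r : R) (U : 'M[R[i]]_2) (N : nat) :
  U * U = - 1 ->
  mxexp_sum (r%:C *: U) N =
  (series (cos_coeff r) N)%:C%:M + (series (sin_coeff r) N)%:C *: U.
Proof.
move=> U2.
elim: N => [|N IH].
  by rewrite /mxexp_sum /series /= !big_nil rmorph0 scale0r addr0.
rewrite /mxexp_sum /series /= !big_nat_recr //= -/(mxexp_sum _ _) IH.
rewrite /series /= !rmorphD /= scalerDl addrACA; congr (_ + _).
have fE : ((N`!%:R)^-1 : R[i]) = ((N`!%:R)^-1 : R)%:C.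
  by rewrite fmorphV /= rmorph_nat.
rewrite exprZn expU // fE -rmorphXn /= /cos_coeff /sin_coeff /=.
case: ifP => oN; rewrite /= ?(mul0r, mul1r, scale0r, addr0, add0r, rmorph0, raddf0).
  rewrite !scalerA -!rmorphM /=; congr (_ *: _); congr (_%:C).
  have -> : N.-1./2 = N./2 by rewrite -(odd_double_half N) oN /= uphalf_double doubleK.
  ring.
rewrite !scale_scalar_mx -!rmorphM /=; congr (_%:M); congr (_%:C).
by rewrite -exprnP; ring.
Qed.

Lemma mxexp_rot (R : realType) (r : R) (U : 'M[R[i]]_2) :
  U * U = - 1 ->
  mxexp (r%:C *: U) = (cos r)%:C%:M + (sin r)%:C *: U.
Proof.
move=> U2; apply/matrixP => i j; rewrite !mxE.
have cc : series (cos_coeff r) @ \oo --> cos r.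
  by rewrite cos.unlock; exact: is_cvg_series_cos_coeff.
have cs : series (sin_coeff r) @ \oo --> sin r.
  by rewrite sin.unlock; exact: is_cvg_series_sin_coeff.
have entry N : mxexp_sum (r%:C *: U) N i j =
    (series (cos_coeff r) N *+ (i == j) + series (sin_coeff r) N * complex.Re (U i j))
    +i* (series (sin_coeff r) N * complex.Im (U i j)).
  rewrite mxexp_sum_rot // !mxE; case: (U i j) => x y.
  by case: (i == j); rewrite ?mulr1n ?mulr0n /=; apply/eqP;
     rewrite eq_complex /= ; apply/andP; split; apply/eqP; ring.
have -> : (cos r)%:C *+ (i == j) + (sin r)%:C * U i j =
    (cos r *+ (i == j) + sin r * complex.Re (U i j))
    +i* (sin r * complex.Im (U i j)).
  case: (U i j) => x y.
  by case: (i == j); rewrite ?mulr1n ?mulr0n /=; apply/eqP;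
     rewrite eq_complex /= ; apply/andP; split; apply/eqP; ring.
congr Complex; apply/cvg_lim => //.
  under eq_fun do rewrite entry /=.
  apply: cvgD; last by apply: cvgMl.
  by case: (i == j); rewrite ?mulr1n ?mulr0n //; exact: cvg_cst.
by under eq_fun do rewrite entry /=; apply: cvgMl.
Qed.


Lemma mxexp_subproof (R : realType) (X : su2 R) : is_SU2 (mxexp (su2_mx X)).
Proof.
pose x := complex.Im (X 0 0); pose y := complex.Re (X 0 1).
pose z := complex.Im (X 0 1); pose r := Num.sqrt (x ^+ 2 + y ^+ 2 + z ^+ 2).
have s0 : 0 <= x ^+ 2 + y ^+ 2 + z ^+ 2 by rewrite !addr_ge0 ?sqr_ge0.
have r2 : r ^+ 2 = x ^+ 2 + y ^+ 2 + z ^+ 2 by rewrite sqr_sqrtr.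
have [p [q [w [e1 [xE yE zE]]]]] : exists p q w : R,
    p ^+ 2 + q ^+ 2 + w ^+ 2 = 1 /\ [/\ x = r * p, y = r * q & z = r * w].
  have [r0|r0] := eqVneq r 0; last first.
    exists (x / r), (y / r), (z / r); split; last by split; field.
    transitivity ((x ^+ 2 + y ^+ 2 + z ^+ 2) / r ^+ 2); first by field.
    by rewrite -r2 divff // expf_neq0.
  exists 1, 0, 0; split; first by ring.
  move: r2 (sqr_ge0 x) (sqr_ge0 y) (sqr_ge0 z); rewrite r0 => r2 x0 y0 z0.
  by split; rewrite mul0r; apply/eqP; rewrite -sqrf_eq0; apply/eqP; lra.
pose U := mx2 (0 +i* p) (q +i* w) (- q +i* w) (0 -i* p).
have XE : su2_mx X = r%:C *: U.
  rewrite (su2_entries X) -/x -/y -/z xE yE zE.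
  by apply: mx2_eqP; rewrite !mxE /=; congr Complex; ring.
have UU : U * U = - 1.
  rewrite -mulmxE; apply: mx2_eqP; rewrite !mxE !big_ord_recl big_ord0 !mxE /=;
  apply/eqP; rewrite eq_complex /=; apply/andP; split; apply/eqP; move: e1; lra.
rewrite XE mxexp_rot //; have := cos2Dsin2 r.
move: (cos r) (sin r) => c s cs.
have {}cs : c ^+ 2 + (s * p) ^+ 2 + (s * q) ^+ 2 + (s * w) ^+ 2 = 1.
  transitivity (c ^+ 2 + s ^+ 2 * (p ^+ 2 + q ^+ 2 + w ^+ 2)); first by ring.
  by rewrite e1 mulr1.
have -> : c%:C%:M + s%:C *: U =
    mx2 (c +i* (s * p)) ((s * q) +i* (s * w))
        (- (s * q) +i* (s * w)) (c -i* (s * p)).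
  by apply: mx2_eqP; rewrite !mxE ?mulr1n ?mulr0n /=; congr Complex; ring.
move: (s * p) (s * q) (s * w) cs => p1 q1 w1 cs.
apply/andP; split; last first.
  rewrite (expand_det_row _ 0) !big_ord_recl big_ord0 /cofactor !det_mx11 !mxE /= eq_complex /=; apply/andP; split; apply/eqP;
  move: cs; lra.
apply/unitarymxP; apply: mx2_eqP;
  rewrite !mxE !big_ord_recl big_ord0 !mxE ?mulr1n ?mulr0n /=;
  apply/eqP; rewrite eq_complex /=; apply/andP; split; apply/eqP; move: cs; lra.
Qed.

Definition SU2_exp (R : realType) (X : su2 R) : SU2 R := MkSU2 (mxexp_subproof X).

(** * Complex-valued differential forms on SU(2) *)

(* The left-invariant vector field X:  (X f)(x) = d/dt f(x exp(t X)) at t = 0.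
   The derivative is total; it is only applied to smooth functions below. *)
Definition lieD (R : realType) (X : su2 R) (f : SU2 R -> R[i]) (x : SU2 R) : R[i] :=
  let c (t : R) := f (SU2_mul x (SU2_exp (su2_scale t X))) in
  (derive1 (fun t => complex.Re (c t)) 0) +i* (derive1 (fun t => complex.Im (c t)) 0).

(* In the left-invariant trivialization, a p-form is given by its components in
   the coframe X_1^*, X_2^*, X_3^*: a 1-form is x |-> \sum_i (w x) 0 i X_i^*, a
   2-form h has the antisymmetric matrix of components h x i j = h_x(X_i, X_j), and
   a 3-form s is s x X_1^* /\ X_2^* /\ X_3^*. *)
Definition form0 (R : realType) := SU2 R -> R[i].
Definition form1 (R : realType) := SU2 R -> 'rV[R[i]]_3.
Definition form2 (R : realType) := SU2 R -> 'M[R[i]]_3.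
Definition form3 (R : realType) := SU2 R -> R[i].

Section Forms.
Context (R : realType) (a b c : R).
Local Notation X := (frame a b c).
Local Notation "[[ Y , Z ]]" := (su2_bracket Y Z) (at level 0).

Definition ev1 (w : form1 R) (Y : su2 R) : form0 R := fun x =>
  \sum_i (dual_frame a b c i Y)%:C * w x 0 i.

Definition ev2 (h : form2 R) (Y Z : su2 R) : form0 R := fun x =>
  \sum_i \sum_j (dual_frame a b c i Y)%:C * (dual_frame a b c j Z)%:C * h x i j.

Definition d0 (f : form0 R) : form1 R := fun x =>
  \row_i lieD (X i) f x.

Definition d1 (w : form1 R) : form2 R := fun x =>
  \matrix_(i, j) (lieD (X i) (ev1 w (X j)) x - lieD (X j) (ev1 w (X i)) x
                  - ev1 w [[X i, X j]] x).

Definition d2 (h : form2 R) : form3 R := fun x =>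
  let Y1 := X 0 in let Y2 := X 1 in let Y3 := X 2 in
  lieD Y1 (ev2 h Y2 Y3) x - lieD Y2 (ev2 h Y1 Y3) x + lieD Y3 (ev2 h Y1 Y2) x
  - ev2 h [[Y1, Y2]] Y3 x + ev2 h [[Y1, Y3]] Y2 x - ev2 h [[Y2, Y3]] Y1 x.

End Forms.

(* The Hodge star of the metric for which (X_1, X_2, X_3) is orthonormal and
   positively oriented: X_1^* |-> X_2^* /\ X_3^* and cyclically,
   X_1^* /\ X_2^* /\ X_3^* |-> 1. *)
Definition eps3 (R : realType) (i j l : 'I_3) : R[i] :=
  if uniq [:: i; j; l]
  then (if (j == i + 1) then 1 else -1) else 0.

Definition star1 (R : realType) (w : form1 R) : form2 R := fun x =>
  \matrix_(i, j) \sum_l eps3 R i j l * w x 0 l.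

Definition star2 (R : realType) (h : form2 R) : form1 R := fun x =>
  \row_l (2^-1 * \sum_i \sum_j eps3 R i j l * h x i j).

Definition star3 (R : realType) (s : form3 R) : form0 R := s.

(* delta = (- 1)^(n (p + 1) + 1) * d *  on p-forms in dimension n = 3. *)
Definition delta1 (R : realType) (a b c : R) (w : form1 R) : form0 R := fun x =>
  - star3 (d2 a b c (star1 w)) x.

Definition delta2 (R : realType) (a b c : R) (h : form2 R) : form1 R :=
  star2 (d1 a b c (star2 h)).

Definition Delta1 (R : realType) (a b c : R) (w : form1 R) : form1 R := fun x =>
  d0 a b c (delta1 a b c w) x + delta2 a b c (d1 a b c w) x.

(** * The representations *)

(* Homogeneous polynomials of degree k in the variables z = 'X_0 and w = 'X_1. *)
Notation Vk R k := (dhomog 2 R[i] k).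

Definition var (R : realType) (j : 'I_2) : mpoly 2 R[i] := mpolyX R[i] (mnm1 j).

Definition subst_mx (R : realType) (M : 'M[R[i]]_2) : 2.-tuple (mpoly 2 R[i]) :=
  [tuple \sum_(j < 2) M i j *: var R j | i < 2].

Lemma var_homog (R : realType) (j : 'I_2) : var R j \is @ishomog1 2 R[i] 1 mdeg.
Proof. by rewrite dhomogX; apply/eqP; exact: mdeg1. Qed.

Lemma subst_mx_homog (R : realType) (M : 'M[R[i]]_2) (i : 'I_2) (n : nat) :
  tnth (subst_mx M) i ^+ n \is @ishomog1 2 R[i] n mdeg.
Proof.
rewrite -[X in ishomog1 X]mul1n; apply: dhomogMn; rewrite tnth_mktuple.
by apply: rpred_sum => j _; apply: rpredZ; exact: var_homog.
Qed.

Lemma rho_subproof (R : realType) (k : nat) (x : SU2 R) (P : Vk R k) :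
  comp_mpoly (subst_mx (SU2_mx (SU2_inv x))) (mpoly_of_dhomog P)
    \is @ishomog1 2 R[i] k mdeg.
Proof.
case: P => p /= hp; rewrite comp_mpolyE big_seq rpred_sum // => m hm.
apply: rpredZ; have <- : mdeg m = k by exact: (dhomogP _ _ _ hp).
rewrite mdegE !big_ord_recl !big_ord0 mulr1 addn0.
by apply: dhomogM; exact: subst_mx_homog.
Qed.

(* (rho x P)(u) = P(x^-1 u) for u = (z, w) in C^2. This is the convention for which
   d rho (E_1) P_l = (k - 2 l) i P_l. *)
Definition rho (R : realType) (k : nat) (x : SU2 R) (P : Vk R k) : Vk R k :=
  DHomog (rho_subproof x P).

Lemma monom_homog (R : realType) (k n : nat) : (n <= k)%N ->
  var R 0 ^+ n * var R 1 ^+ (k - n) \is @ishomog1 2 R[i] k mdeg.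
Proof.
move=> nk; rewrite -[k in X in _ \is X](subnKC nk).
by apply: dhomogM; rewrite -[X in ishomog1 X]mul1n; apply: dhomogMn; exact: var_homog.
Qed.

(* P_l = z^l w^(k - l), and P_l = 0 for l < 0 and l > k. *)
Definition Pl (R : realType) (k : nat) (l : int) : Vk R k :=
  match l with
  | Posz n => match @idP (n <= k)%N with
              | ReflectT nk => DHomog (monom_homog R nk)
              | ReflectF _ => 0
              end
  | Negz _ => 0
  end.

(* For v in V_k and L in Hom(V_k, su(2)_C^* ), omega v L x = L(rho(x^-1) v). *)
Definition omega (R : realType) (k : nat) (v : Vk R k)
    (L : 'Hom(Vk R k, 'rV[R[i]]_3)) : form1 R := fun x =>
  L (rho (SU2_inv x) v).

(* The operator D on Hom(V_k, su(2)_C^* ) with Delta1 (omega v L) = omega v (D L). *)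
Definition Delta1_Hom (R : realType) (a b c : R) (k : nat) :
    'End('Hom(Vk R k, 'rV[R[i]]_3)) :=
  xget 0 [set D : 'End('Hom(Vk R k, 'rV[R[i]]_3)) |
    forall v L, Delta1 a b c (omega v L) =1 omega v (D L)].

Definition equivariant_iso (R : realType) (k : nat)
    (phi : 'Hom(Vk R k, 'Hom(Vk R k, R[i]^o))) : Prop :=
  bijective phi /\
  forall (x : SU2 R) (P Q : Vk R k), phi (rho x P) Q = phi P (rho (SU2_inv x) Q).

(* V_k (x) su(2)_C^*, an element \sum_i p_i (x) X_i^* being the family of the p_i. *)
Notation tens R k := {ffun 'I_3 -> Vk R k}.

Definition tensor (R : realType) (k : nat) (P : Vk R k) (xi : 'rV[R[i]]_3) :
    tens R k :=
  [ffun i => xi 0 i *: P].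

Definition dualX (R : realType) (i : 'I_3) : 'rV[R[i]]_3 := delta_mx 0 i.

Section TensHom.
Context (R : realType) (k : nat) (phi : 'Hom(Vk R k, 'Hom(Vk R k, R[i]^o))).

Definition tens_Hom_row (t : tens R k) (v : Vk R k) : 'rV[R[i]]_3 :=
  \row_i (phi (t i) v : R[i]).

Fact tens_Hom_row_linear (t : tens R k) : linear (tens_Hom_row t).
Proof. by move=> d u v; apply/rowP => i; rewrite !mxE linearP. Qed.

HB.instance Definition _ (t : tens R k) :=
  GRing.isLinear.Build R[i] (Vk R k) 'rV[R[i]]_3 _ (tens_Hom_row t)
    (tens_Hom_row_linear t).

Definition tens_Hom_fun (t : tens R k) : 'Hom(Vk R k, 'rV[R[i]]_3) :=
  linfun (tens_Hom_row t).

Fact tens_Hom_fun_linear : linear tens_Hom_fun.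
Proof.
move=> d s t; apply/lfunP => v; rewrite add_lfunE scale_lfunE !lfunE /=.
by apply/rowP => i; rewrite !mxE !ffunE linearP add_lfunE scale_lfunE.
Qed.

HB.instance Definition _ :=
  GRing.isLinear.Build R[i] (tens R k) 'Hom(Vk R k, 'rV[R[i]]_3) _ tens_Hom_fun
    tens_Hom_fun_linear.

(* The map P (x) xi |-> (v |-> phi(P)(v) xi) onto Hom(V_k, su(2)_C^* ). *)
Definition tens_Hom : 'Hom(tens R k, 'Hom(Vk R k, 'rV[R[i]]_3)) :=
  linfun tens_Hom_fun.

Lemma tens_HomE (P : Vk R k) (xi : 'rV[R[i]]_3) (v : Vk R k) :
  tens_Hom (tensor P xi) v = (phi P v : R[i]) *: xi.
Proof.
rewrite !lfunE /=; apply/rowP => i; rewrite !mxE ffunE linearZ scale_lfunE.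
exact: mulrC.
Qed.

End TensHom.

Definition Delta1_tens (R : realType) (a b c : R) (k : nat)
    (phi : 'Hom(Vk R k, 'Hom(Vk R k, R[i]^o))) : 'End(tens R k) :=
  ((tens_Hom phi)^-1 \o Delta1_Hom a b c k \o tens_Hom phi)%VF.

(** * Eigenvectors and eigenvalues *)

Section Eigenvectors.
Context (R : realType) (a b : R) (k : nat).
Local Notation P := (@Pl R k).
Local Notation X1 := (dualX R 0).
Local Notation X23p := (dualX R 1 + 'i *: dualX R 2).
Local Notation X23m := (dualX R 1 - 'i *: dualX R 2).
Local Notation "P (x) xi" := (tensor P xi) (at level 45).
Local Notation K := (k%:R : R).

Definition v_ (j : nat) : tens R k :=
  ((j%:R * (b / a))%:C * 'i) *: (P (j%:Z - 1) (x) X23p)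
  + (K - 2 * j%:R)%:C *: (P j%:Z (x) X1)
  - (((K - j%:R) * (b / a))%:C * 'i) *: (P (j%:Z + 1) (x) X23m).

Definition w_m1 : tens R k := P 0 (x) X23m.

Definition w_0 : tens R k :=
  (2 * (b / a))%:C *: (P 0 (x) X1) + ('i * K%:C) *: (P 1 (x) X23m).

Definition w_k1 : tens R k := P k%:Z (x) X23p.

Definition w_k : tens R k :=
  ('i * K%:C) *: (P (k%:Z - 1) (x) X23p) + (2 * (b / a))%:C *: (P k%:Z (x) X1).

Definition S_ (j : nat) : R :=
  Num.sqrt (a ^+ 4 * (K - 2 * j%:R) ^+ 2
            + a ^+ 2 * b ^+ 2 * (2 * K + 4 * j%:R * (K - j%:R)) + b ^+ 4).

(* In the families with a superscript +/-, the sign is given by s = 1 or s = -1. *)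
Definition alpha (s : R) (j : nat) : R :=
  (2 * (K - 2 * j%:R) ^+ 2 * a ^+ 2 + (2 * K + 4 * j%:R * (K - j%:R)) * b ^+ 2
   - s * (2 * (K - 2 * j%:R) * S_ j))
  / (4 * (K - j%:R + 1) * b ^+ 2).

Definition beta (s : R) (j : nat) : R :=
  (- a ^+ 2 * (K - 2 * j%:R) + b ^+ 2 + s * S_ j) / (a * b).

Definition gamma (s : R) (j : nat) : R := K - j%:R.

Definition w_pm (s : R) (j : nat) : tens R k :=
  ('i * (alpha s j)%:C) *: (P (j%:Z - 1) (x) X23p)
  + (beta s j)%:C *: (P j%:Z (x) X1)
  + ('i * (gamma s j)%:C) *: (P (j%:Z + 1) (x) X23m).

Definition nu (j : nat) : R :=
  a ^+ 2 * (K - 2 * j%:R) ^+ 2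
  + b ^+ 2 * ((4 * j%:R + 2) * K - 4 * j%:R ^+ 2).

(* The common value of mu_{k,-1} and mu_{k,k+1}. *)
Definition mu_m1 : R := (K + 2) ^+ 2 * a ^+ 2.

(* The common value of mu_{k,0} and mu_{k,k}. *)
Definition mu_0 : R := K ^+ 2 * a ^+ 2 + 4 * K * b ^+ 2 + 4 * (b ^+ 4 / a ^+ 2).

Definition mu_pm (s : R) (j : nat) : R :=
  nu j + 2 * (b ^+ 4 / a ^+ 2)
  + s * (2 * (b ^+ 2 / a ^+ 2) * Num.sqrt (a ^+ 2 * nu j + b ^+ 4)).

Definition eigenvectors : seq (tens R k) :=
  [seq v_ j | j <- iota 0 k.+1]
  ++ [:: w_m1; w_0; w_k; w_k1]
  ++ [seq w_pm 1 j | j <- iota 1 k.-1]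
  ++ [seq w_pm (-1) j | j <- iota 1 k.-1].

End Eigenvectors.

(* Main.v *)
(* In the left-invariant trivialization, X_i acts on matrix coefficients of V_k by
   d rho_k (X_i), so Delta_1^(k) = curl o curl + grad o codiff, where
   codiff t = - sum_i X_i t_i,
   (curl t)_i = X_(i+1) t_(i+2) - X_(i+2) t_(i+1) - c_i t_i,
   and c_i is the structure constant in [X_(i+1), X_(i+2)] = c_i X_i.  Since c = b,
   curl, grad and codiff respect the blocks spanned by P_(j-1) (x) (X_2 + i X_3),
   P_j (x) X_1 and P_(j+1) (x) (X_2 - i X_3).  Each v_j is a multiple of grad P_j, which
   is curl free, and each w is a divergence free eigenvector of curl, so that its
   eigenvalue under Delta_1 is a square: for w_j^(+-) the eigenvalue of curl is
   -(b^2 +- S_j) / a. *)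
From HB Require Import structures.
Require Import Defs.
From mathcomp Require Import all_boot all_order all_algebra.
From mathcomp Require Import complex ring zify.
From mathcomp Require Import all_classical all_reals all_analysis.
From mathcomp Require mpoly.
Import -(notations) mpoly.

Set Implicit Arguments.
Unset Strict Implicit.
Unset Printing Implicit Defensive.

Import Order.TTheory GRing.Theory Num.Theory.
Import numFieldNormedType.Exports.
Local Open Scope complex_scope.
Local Open Scope ring_scope.

(** * Derivatives at 0 of complex and of polynomial paths *)

(** [Delta1_Hom] is a choice with default value, so nothing is known about it before some operator
    with the defining property is exhibited. Conjugating [Dt] by [tens_Hom phi] gives one; any other
    agrees with it, because evaluating [omega v (D L)] at the identity of SU(2) recovers [D L v].
    The action on matrix coefficients hides a transfer: a left-invariant derivative of
    phi(P)(rho(x^-1) v) falls on v, while [Dt] acts on P. The derivative of the equivariance of phi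
    at the identity moves it over, with a sign. [lieD] is built on a total derivative, so existence
    of each derivative has to be proved. This stays elementary: rho is a linear substitution in a
    polynomial and exp(t X_i) is an explicit combination of 1 and E_i, so it is enough to
    differentiate finitely many coefficients. For the basis, the blocks j = -1, 0, 1, ..., k-1, k,
    k+1 have dimensions 1, 2, 3, ..., 3, 2, 1. The listed vectors span each block, and their number
    is the total dimension 3(k+1). *)

Section ComplexPaths.
Context (R : realType).
Implicit Types (f g : R -> R[i]) (y z : R[i]).

(** Split into real and imaginary part as in [lieD]; [is_derive] carries the existence of the
    derivative along with its value. *)
Definition cdiff0 f z :=
  is_derive (0 : R) 1 (fun t => complex.Re (f t)) (complex.Re z) /\
  is_derive (0 : R) 1 (fun t => complex.Im (f t)) (complex.Im z).

Lemma cdiff0_cst z : cdiff0 (fun=> z) 0.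
Proof. by split; exact: is_derive_cst. Qed.

Lemma ReD y z : complex.Re (y + z) = complex.Re y + complex.Re z.
Proof. by case: y z => [? ?] [? ?]. Qed.

Lemma ImD y z : complex.Im (y + z) = complex.Im y + complex.Im z.
Proof. by case: y z => [? ?] [? ?]. Qed.

Lemma cdiff0D f g y z : cdiff0 f y -> cdiff0 g z -> cdiff0 (fun t => f t + g t) (y + z).
Proof.
case=> fr fi [gr gi]; split.
  by rewrite ReD; under eq_fun do rewrite ReD; exact: is_deriveD.
by rewrite ImD; under eq_fun do rewrite ImD; exact: is_deriveD.
Qed.

Lemma ReM y z : complex.Re (y * z) =
  complex.Re y * complex.Re z - complex.Im y * complex.Im z.
Proof. by case: y z => [? ?] [? ?]. Qed.

Lemma ImM y z : complex.Im (y * z) =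
  complex.Re y * complex.Im z + complex.Im y * complex.Re z.
Proof. by case: y z => [? ?] [? ?]. Qed.

Lemma cdiff0M f g y z : cdiff0 f y -> cdiff0 g z ->
  cdiff0 (fun t => f t * g t) (y * g 0 + f 0 * z).
Proof.
case=> fr fi [gr gi]; split.
  under eq_fun do rewrite ReM.
  have h := is_deriveB (is_deriveM fr gr) (is_deriveM fi gi).
  apply: (is_derive_eq h).
  by rewrite ReD !ReM /GRing.scale /=; ring.
under eq_fun do rewrite ImM.
have h := is_deriveD (is_deriveM fr gi) (is_deriveM fi gr).
apply: (is_derive_eq h).
by rewrite ImD !ImM /GRing.scale /=; ring.
Qed.

Lemma cdiff0_sum I (r : seq I) (P : pred I) (F : I -> R -> R[i]) (z : I -> R[i]) :
  (forall i, P i -> cdiff0 (F i) (z i)) ->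
  cdiff0 (fun t => \sum_(i <- r | P i) F i t) (\sum_(i <- r | P i) z i).
Proof.
move=> h; elim: r => [|i r IH].
  by rewrite big_nil; under eq_fun do rewrite big_nil; exact: cdiff0_cst.
rewrite big_cons; under eq_fun do rewrite big_cons.
by case: ifP => // Pi; apply: cdiff0D => //; exact: h.
Qed.

Lemma cdiff0_eq f y z : cdiff0 f y -> y = z -> cdiff0 f z.
Proof. by move=> h <-. Qed.

Lemma cdiff0_derive f z : cdiff0 f z ->
  (fun t => complex.Re (f t))^`()%classic 0
  +i* (fun t => complex.Im (f t))^`()%classic 0 = z.
Proof.
by case=> [hr hi]; rewrite !derive1E !derive_val; case: z {hr hi}.
Qed.

Lemma cdiff0_unique f y z : cdiff0 f y -> cdiff0 f z -> y = z.
Proof. by move=> /cdiff0_derive <- /cdiff0_derive <-. Qed.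

End ComplexPaths.

Section PolynomialPaths.
Context (R : realType) (n : nat).
Local Notation poly := (mpoly n R[i]).
Implicit Types (p q : R -> poly) (u v : poly).

(** Coefficientwise, which avoids a topology on polynomials. *)
Definition pdiff0 p u := forall m, cdiff0 (fun t => mcoeff m (p t)) (mcoeff m u).

Lemma pdiff0_cst u : pdiff0 (fun=> u) 0.
Proof. by move=> m; rewrite mcoeff0; exact: cdiff0_cst. Qed.

Lemma pdiff0_sum I (r : seq I) (P : pred I) (F : I -> R -> poly) (v : I -> poly) :
  (forall i, P i -> pdiff0 (F i) (v i)) ->
  pdiff0 (fun t => \sum_(i <- r | P i) F i t) (\sum_(i <- r | P i) v i).
Proof.
move=> h m; rewrite raddf_sum; under eq_fun do rewrite raddf_sum.
by apply: cdiff0_sum => i Pi; exact: h.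
Qed.

Lemma pdiff0Z (f : R -> R[i]) z u : cdiff0 f z ->
  pdiff0 (fun t => f t *: u) (z *: u).
Proof.
move=> h m; rewrite mcoeffZ; under eq_fun do rewrite mcoeffZ.
by apply: cdiff0_eq; [exact: (cdiff0M h (cdiff0_cst _))|rewrite mulr0 addr0].
Qed.

(** A coefficient of a product is a finite sum whose index set depends only on the monomial [m], not
    on [t], so the scalar product rule applies term by term. *)
Lemma pdiff0M p q u v : pdiff0 p u -> pdiff0 q v ->
  pdiff0 (fun t => p t * q t) (u * q 0 + p 0 * v).
Proof.
move=> hp hq m; rewrite mcoeffD !(mcoeffM _ _ m) -big_split /=.
under eq_fun do rewrite mcoeffM.
by apply: cdiff0_sum => i _; exact: cdiff0M.
Qed.

Lemma pdiff0_eq p u v : pdiff0 p u -> u = v -> pdiff0 p v.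
Proof. by move=> h <-. Qed.

Lemma mpolyX_ind (Q : poly -> Prop) :
  Q 1 -> (forall u v, Q u -> Q v -> Q (u * v)) ->
  (forall i, Q (mpolyX R[i] (mnm1 i))) -> forall m, Q (mpolyX R[i] m).
Proof.
move=> Q1 QM QX m; rewrite mpolyXE_id.
elim/big_ind: _ => // i _; elim: (m i) => [|d IH]; first by rewrite expr0.
by rewrite exprS; apply: QM.
Qed.

(** Chain rule at a path starting at the identity substitution, so that the partial derivatives
    appear unsubstituted. The set of good polynomials contains 1 and the variables and is closed
    under products by the Leibniz rule, hence contains all monomials; linearity does the rest. *)
Lemma pdiff0_comp (lq : R -> n.-tuple poly) (dq : 'I_n -> poly) :
  (forall i, tnth (lq 0) i = mpolyX R[i] (mnm1 i)) ->
  (forall i, pdiff0 (fun t => tnth (lq t) i) (dq i)) ->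
  forall u, pdiff0 (fun t => comp_mpoly (lq t) u) (\sum_i dq i * mderiv i u).
Proof.
move=> lq0 dlq.
have lq0E u : comp_mpoly (lq 0) u = u.
  have -> : lq 0 = [tuple mpolyX R[i] (mnm1 i) | i < n].
    by apply: eq_from_tnth => i; rewrite tnth_mktuple lq0.
  exact: comp_mpoly_id.
pose ok u := pdiff0 (fun t => comp_mpoly (lq t) u) (\sum_i dq i * mderiv i u).
have okM u v : ok u -> ok v -> ok (u * v).
  move=> hu hv; rewrite /ok; under eq_fun do rewrite rmorphM /=.
  apply: pdiff0_eq; first exact: (pdiff0M hu hv).
  rewrite /= !lq0E mulr_suml mulr_sumr -big_split /=; apply: eq_bigr => i _.
  by rewrite mderivM; ring.
have ok1 : ok 1.
  rewrite /ok; under eq_fun do rewrite comp_mpoly1.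
  rewrite big1 => [|i _]; first exact: pdiff0_cst.
  by rewrite -mpolyC1 mderivC mulr0.
have okX i : ok (mpolyX R[i] (mnm1 i)).
  rewrite /ok; under eq_fun do rewrite comp_mpolyXU -tnth_nth.
  apply: pdiff0_eq; first exact: dlq.
  rewrite (bigD1 i) //= big1 => [|j ji]; rewrite mderivX mnm1E.
    have -> : mnm_sub (mnm1 i) (mnm1 i) = @mnm0 n.
      by apply/mnmP => j; rewrite mnmBE mnm0E subnn.
    by rewrite eqxx scale1r mpolyX0 mulr1 addr0.
  by rewrite eq_sym (negPf ji) scale0r mulr0.
move=> u; rewrite (mpolyE u).
have -> : (fun t => comp_mpoly (lq t) (\sum_(m <- msupp u) mcoeff m u *: mpolyX R[i] m)) =
   (fun t => \sum_(m <- msupp u) mcoeff m u *: comp_mpoly (lq t) (mpolyX R[i] m)).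
  by apply/funext => t; rewrite raddf_sum; apply: eq_bigr => m _; rewrite /= comp_mpolyZ.
apply: pdiff0_eq.
  apply: (@pdiff0_sum _ _ _ _ (fun m => mcoeff m u *: \sum_i dq i * mderiv i (mpolyX R[i] m))).
  move=> m _ m'; rewrite mcoeffZ; under eq_fun do rewrite mcoeffZ.
  apply: cdiff0_eq.
    apply: cdiff0M; first exact: cdiff0_cst.
    exact: (mpolyX_ind ok1 okM okX m).
  by rewrite mul0r add0r.
under eq_bigr do rewrite scaler_sumr.
rewrite exchange_big /=; apply: eq_bigr => i _.
rewrite raddf_sum mulr_sumr; apply: eq_bigr => m _.
by rewrite /= mderivZ scalerAr.
Qed.

End PolynomialPaths.

Arguments Pl : simpl never.

(** * The monomial basis of V_k *)

Section Monomials.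
Context (R : realType) (k : nat).

Definition mexp (l : nat) : multinom 2 :=
  mnm_add (mnm_muln (mnm1 0) l) (mnm_muln (mnm1 1) (k - l)).

Lemma mexp0 l : mexp l 0 = l.
Proof. by rewrite mnmDE !mulmnE !mnm1E mul1n mul0n addn0. Qed.

Lemma mexp1 l : mexp l 1 = (k - l)%N.
Proof. by rewrite mnmDE !mulmnE !mnm1E mul1n mul0n. Qed.

Lemma ord2E (x : 'I_2) : x = 0 \/ x = 1.
Proof. by case: x => [[|[|x]] hx] //; [left|right]; apply/val_inj. Qed.

Lemma multinom2P (m m' : multinom 2) : m 0 = m' 0 -> m 1 = m' 1 -> m = m'.
Proof. by move=> h0 h1; apply/mnmP => i; case: (ord2E i) => ->. Qed.

Lemma mdeg2 (m : multinom 2) : mdeg m = (m 0%R + m 1%R)%N.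
Proof.
rewrite mdegE big_ord_recl big_ord1.
by congr (_ + m _)%N; apply/val_inj.
Qed.

Lemma Pl_nat l : (l <= k)%N -> mpoly_of_dhomog (Pl R k l) = mpolyX R[i] (mexp l).
Proof.
move=> lk; rewrite /Pl; case: {-}_ / idP => [h|] //=.
by rewrite !mpolyXn -mpolyXD.
Qed.

Lemma Pl_out (l : int) : (l < 0) || (k%:Z < l) -> Pl R k l = 0.
Proof.
case: l => l //=; rewrite ltz_nat => kl.
by rewrite /Pl; case: {-}_ / idP => [h|] //=; lia.
Qed.

Lemma Vk_decomp (P : Vk R k) :
  P = \sum_(l < k.+1) mcoeff (mexp l) (mpoly_of_dhomog P) *: Pl R k l%:Z.
Proof.
apply/val_inj => /=; apply/mpolyP => m.
rewrite linear_sum raddf_sum /=.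
under eq_bigr => l _ do rewrite linearZ /= Pl_nat -1?ltnS // mcoeffX.
have [mk|mk] := eqVneq (mdeg m) k.
  have m0 : (m 0%R < k.+1)%N by rewrite ltnS -mk mdeg2 leq_addr.
  have mE : m = mexp (m 0).
    by apply: multinom2P; rewrite ?mexp0 ?mexp1 -?mk ?mdeg2 ?addKn.
  rewrite (bigD1 (Ordinal m0)) //= big1 => [|l lm].
    by rewrite -mE eqxx mulr1 addr0.
  rewrite [_ == _](_ : _ = false) ?mulr0 //; apply/negP => /eqP lE.
  by move/eqP: lm; apply; apply/val_inj; rewrite /= -lE mexp0.
rewrite (dhomog_nemf_coeff (dhomog_is_dhomog P) mk) big1 // => l _.
rewrite [_ == _](_ : _ = false) ?mulr0 //; apply/negP => /eqP lE.
by move/eqP: mk; apply; rewrite -lE mdeg2 mexp0 mexp1 subnKC // -ltnS.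
Qed.

Lemma cdiff0_linear (f : {linear Vk R k -> R[i]^o}) (P : R -> Vk R k) (Q : Vk R k) :
  pdiff0 (fun t => mpoly_of_dhomog (P t)) (mpoly_of_dhomog Q) ->
  cdiff0 (fun t => f (P t) : R[i]) (f Q).
Proof.
move=> h.
have fE u : f u = \sum_(l < k.+1) mcoeff (mexp l) (mpoly_of_dhomog u) * f (Pl R k l%:Z).
  by rewrite {1}(Vk_decomp u) linear_sum; apply: eq_bigr => l _; rewrite linearZ.
under eq_fun do rewrite fE.
rewrite fE; apply: cdiff0_sum => l _.
by apply: cdiff0_eq; [exact: (cdiff0M (h _) (cdiff0_cst _))|rewrite mulr0 addr0].
Qed.

End Monomials.

(** * Linear substitutions and the derivations they generate *)

Section Derivation.
Context (R : realType).
Implicit Types (M N : 'M[R[i]]_2).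

Lemma subst_mx_comp M N (p : mpoly 2 R[i]) :
  comp_mpoly (subst_mx N) (comp_mpoly (subst_mx M) p) = comp_mpoly (subst_mx (M *m N)) p.
Proof.
have hX i : comp_mpoly (subst_mx N) (tnth (subst_mx M) i) = tnth (subst_mx (M *m N)) i.
  rewrite !tnth_mktuple raddf_sum /=.
  under eq_bigr do rewrite comp_mpolyZ comp_mpolyXU -tnth_nth tnth_mktuple scaler_sumr.
  rewrite exchange_big /=; apply: eq_bigr => j _.
  by rewrite mxE scaler_suml; apply: eq_bigr => l _; rewrite scalerA.
rewrite (comp_mpolyEX p) raddf_sum (comp_mpolyEX p); apply: eq_bigr => m _.
rewrite /= comp_mpolyZ !comp_mpolyX rmorph_prod; congr (_ *: _).
by apply: eq_bigr => i _; rewrite rmorphXn /= hX.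
Qed.

Lemma der_subproof k M (P : Vk R k) :
  \sum_i tnth (subst_mx M) i * mderiv i (mpoly_of_dhomog P) \is @ishomog1 2 R[i] k mdeg.
Proof.
apply: rpred_sum => i _; rewrite tnth_mktuple mulr_suml rpred_sum // => j _.
rewrite -scalerAl; apply: rpredZ; rewrite [mpoly_of_dhomog P]mpolyE raddf_sum.
rewrite mulr_sumr big_seq rpred_sum // => m /(dhomogP _ _ _ (dhomog_is_dhomog P)) mk.
rewrite /= mderivZ mderivX -!scalerAr; apply: rpredZ.
(* When [m i = 0] the truncated exponent [m - e_i] has the wrong degree, but its coefficient is 0.
   Otherwise the linear form restores the degree lost by differentiation. *)
have [->|mi] := eqVneq (m i) 0%N; first by rewrite scale0r rpred0.
apply: rpredZ; rewrite /var -mpolyXD dhomogX mfD [X in (X + _)%N]mdeg1.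
have /submK E : lem (mnm1 i) m by rewrite lep1mP.
by have := mdegD (mnm_sub m (mnm1 i)) (mnm1 i); rewrite E mdeg1 mk addnC => <-.
Qed.

(* The derivative at 0 of P(e(t) u) along a path e with e(0) = 1, e'(0) = M. *)
Definition der k M (P : Vk R k) : Vk R k := DHomog (der_subproof M P).

Fact der_linear k M : linear (@der k M).
Proof.
move=> c P Q; apply/val_inj; rewrite /= scaler_sumr -big_split.
by apply: eq_bigr => i _; rewrite /= mderivD mderivZ mulrDr scalerAr.
Qed.

HB.instance Definition _ k M :=
  GRing.isLinear.Build R[i] (Vk R k) (Vk R k) _ (@der k M) (@der_linear k M).

Lemma pdiff0_subst k (e : R -> 'M[R[i]]_2) M (P : Vk R k) :
  e 0 = 1%:M -> (forall i j, cdiff0 (fun t => e t i j) (M i j)) ->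
  pdiff0 (fun t => comp_mpoly (subst_mx (e t)) (mpoly_of_dhomog P))
         (mpoly_of_dhomog (der M P)).
Proof.
move=> e0 he; apply: pdiff0_comp => i.
  rewrite tnth_mktuple e0 (bigD1 i) //= big1 => [|j ji].
    by rewrite mxE eqxx scale1r addr0.
  by rewrite mxE eq_sym (negPf ji) scale0r.
rewrite tnth_mktuple; under eq_fun do rewrite tnth_mktuple.
by apply: pdiff0_sum => j _; exact: pdiff0Z.
Qed.

Lemma derZ k (c : R[i]) M (P : Vk R k) : der (c *: M) P = c *: der M P.
Proof.
apply/val_inj; rewrite /= scaler_sumr; apply: eq_bigr => i _ /=.
rewrite scalerAl; congr (_ * _); rewrite !tnth_mktuple scaler_sumr.
by apply: eq_bigr => j _; rewrite mxE scalerA.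
Qed.

Lemma der_mx2_Pl k (x y z t : R[i]) (l : nat) : (l <= k)%N ->
  der (mx2 x y z t) (Pl R k l%:Z) =
    (x * l%:R + t * (k - l)%:R) *: Pl R k l%:Z
    + (y * l%:R) *: Pl R k (l%:Z - 1) + (z * (k - l)%:R) *: Pl R k (l%:Z + 1).
Proof.
move=> lk; apply/val_inj => /=.
rewrite big_ord_recl big_ord1 !tnth_mktuple !big_ord_recl !big_ord0 !mxE /= !addr0.
have -> : lift ord0 ord0 = 1 :> 'I_2 by apply/val_inj.
rewrite Pl_nat // !mderivX mexp0 mexp1 /var.
(* In these four identities the scalar stays on both sides: [l] or [k - l] is 0 exactly where the
   subtraction of exponents would truncate. *)
have X0 : l%:R *: (mpolyX R[i] (mnm1 0) * mpolyX R[i] (mnm_sub (mexp k l) (mnm1 0)))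
    = l%:R *: mpolyX R[i] (mexp k l).
  case: l lk => [|l] lk; first by rewrite !scale0r.
  rewrite -mpolyXD; congr (_ *: mpolyX _ _).
  by apply: multinom2P; rewrite mnmDE mnmBE ?mexp0 ?mexp1 !mnm1E /=; lia.
have X1 : l%:R *: (mpolyX R[i] (mnm1 1) * mpolyX R[i] (mnm_sub (mexp k l) (mnm1 0)))
    = l%:R *: mpoly_of_dhomog (Pl R k (l%:Z - 1)).
  case: l lk {X0} => [|l] lk; first by rewrite !scale0r.
  have -> : l.+1%:Z - 1 = l by lia.
  rewrite -mpolyXD Pl_nat 1?ltnW //; congr (_ *: mpolyX _ _).
  by apply: multinom2P; rewrite mnmDE mnmBE ?mexp0 ?mexp1 !mnm1E /=; lia.
have Y0 : (k - l)%:R *: (mpolyX R[i] (mnm1 0) * mpolyX R[i] (mnm_sub (mexp k l) (mnm1 1)))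
    = (k - l)%:R *: mpoly_of_dhomog (Pl R k (l%:Z + 1)).
  have [kl|lk'] := leqP k l; first by rewrite (_ : (k - l)%N = 0%N) ?scale0r //; lia.
  have -> : l%:Z + 1 = l.+1 by lia.
  rewrite -mpolyXD Pl_nat //; congr (_ *: mpolyX _ _).
  by apply: multinom2P; rewrite mnmDE mnmBE ?mexp0 ?mexp1 !mnm1E /=; lia.
have Y1 : (k - l)%:R *: (mpolyX R[i] (mnm1 1) * mpolyX R[i] (mnm_sub (mexp k l) (mnm1 1)))
    = (k - l)%:R *: mpolyX R[i] (mexp k l).
  have [kl|lk'] := leqP k l; first by rewrite (_ : (k - l)%N = 0%N) ?scale0r //; lia.
  rewrite -mpolyXD; congr (_ *: mpolyX _ _).
  by apply: multinom2P; rewrite mnmDE mnmBE ?mexp0 ?mexp1 !mnm1E /=; lia.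
rewrite !mulrDl -!scalerAl -!scalerAr -!(scalerA _ _ (_ : mpoly 2 R[i])).
rewrite scalerDl -!scalerA X0 X1 Y0 Y1.
by rewrite [X in _ + X = _]addrC addrA [X in X + _ = _]addrAC.
Qed.

End Derivation.

(** * The infinitesimal action *)

Section OneParameterSubgroups.
Context (R : realType) (a b c : R).
Implicit Types (i : 'I_3) (t : R).
Local Notation X := (frame a b c).

Lemma Emx_sq i : Emx R i * Emx R i = - 1.
Proof.
rewrite -mulmxE /Emx (tnth_nth 0).
apply: mx2_eqP; case: i => [[|[|[|i]]] hi] //=; rewrite !mxE !big_ord_recl big_ord0 !mxE /=;
  by apply/eqP; rewrite eq_complex /=; apply/andP; split; apply/eqP; ring.
Qed.

(** The closed form of exp(p t E_i), available because E_i squares to -1. *)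
Definition rot_mx (p t : R) i : 'M[R[i]]_2 :=
  (cos (p * t))%:C%:M + (sin (p * t))%:C *: Emx R i.

Lemma SU2_expE i t : SU2_mx (SU2_exp (su2_scale t (X i))) = rot_mx (par a b c i) t i.
Proof.
rewrite /rot_mx -(mxexp_rot _ (Emx_sq i)); congr mxexp.
by rewrite [LHS]scalerA -rmorphM mulrC.
Qed.

Lemma rot_mxN p i t : rot_mx p t i *m rot_mx p (- t) i = 1%:M.
Proof.
have sq (y z : R[i]) : (y%:M + z *: Emx R i) *m (y%:M - z *: Emx R i) = (y ^+ 2 + z ^+ 2)%:M.
  rewrite mulmxBr !mulmxDl mul_mx_scalar mul_scalar_mx mul_mx_scalar.
  rewrite -scalemxAl -scalemxAr mulmxE Emx_sq scale_scalar_mx opprD addrA.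
  by rewrite addrK scalerA scalerN opprK (scalemx1 _ (z * z)) raddfD.
rewrite /rot_mx mulrN cosN sinN rmorphN scaleNr sq -!rmorphXn -rmorphD.
by rewrite cos2Dsin2.
Qed.

Lemma SU2_exp_invE i t :
  SU2_mx (SU2_inv (SU2_exp (su2_scale t (X i)))) = rot_mx (par a b c i) (- t) i.
Proof.
have [h _] := mulmx1_unit (rot_mxN (par a b c i) i t).
rewrite -[LHS]/(invmx (SU2_mx (SU2_exp _))) SU2_expE.
by rewrite -[RHS](mulKmx h) rot_mxN mulmx1.
Qed.

Lemma rot_mx0 p i : rot_mx p 0 i = 1%:M.
Proof. by rewrite /rot_mx mulr0 cos0 sin0 scale0r addr0. Qed.

Lemma cdiff0_real (f : R -> R) (y : R) : is_derive (0 : R) 1 f y ->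
  cdiff0 (fun t => (f t)%:C) y%:C.
Proof. by move=> h; split => //=; exact: is_derive_cst. Qed.

(** The sign [s] serves both uses: s = 1 for exp(t X_i) and s = -1 for its inverse. *)
Lemma cdiff0_rot s p i (l m : 'I_2) :
  cdiff0 (fun t => rot_mx p (s * t) i l m) (((s * p)%:C *: Emx R i) l m).
Proof.
have hl : is_derive (0 : R) 1 (fun t => p * (s * t)) (s * p).
  have h := is_deriveZ (p * s) (is_derive_id (0 : R) 1).
  have -> : (fun t : R => p * (s * t)) = (p * s) \*: (fun t : R => t).
    by apply/funext => t; rewrite /= /GRing.scale /= mulrA.
  by apply: (is_derive_eq h); rewrite /GRing.scale /= mulr1 mulrC.
have hc : is_derive (0 : R) 1 (fun t => cos (p * (s * t))) 0.
  apply: (is_derive_eq (@is_derive1_comp _ cos _ _ _ _ (is_derive_cos _) hl)).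
  by rewrite !mulr0 sin0 oppr0 mul0r.
have hs : is_derive (0 : R) 1 (fun t => sin (p * (s * t))) (s * p).
  apply: (is_derive_eq (@is_derive1_comp _ sin _ _ _ _ (is_derive_sin _) hl)).
  by rewrite !mulr0 cos0 mul1r.
have -> : (fun t => rot_mx p (s * t) i l m) =
  (fun t => (cos (p * (s * t)))%:C * (l == m)%:R + (sin (p * (s * t)))%:C * Emx R i l m).
  by apply/funext => t; rewrite /rot_mx !mxE mulr_natr.
apply: cdiff0_eq.
  apply: cdiff0D; apply: cdiff0M; (exact: cdiff0_cst || exact: cdiff0_real).
by rewrite mxE !mulr0 !addr0 mul0r add0r.
Qed.

Lemma pdiff0_rot k s i (P : Vk R k) :
  pdiff0 (fun t => comp_mpoly (subst_mx (rot_mx (par a b c i) (s * t) i)) (mpoly_of_dhomog P))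
         (mpoly_of_dhomog (s%:C *: der (su2_mx (X i)) P)).
Proof.
have -> : s%:C *: der (su2_mx (X i)) P = der ((s * par a b c i)%:C *: Emx R i) P.
  by rewrite !derZ scalerA rmorphM.
apply: pdiff0_subst => [|l m]; last exact: cdiff0_rot.
by rewrite mulr0 rot_mx0.
Qed.

Lemma SU2_invK (x : SU2 R) : SU2_mx (SU2_inv (SU2_inv x)) = SU2_mx x.
Proof. exact: invmxK. Qed.

Lemma rho_inv_mul k (x y : SU2 R) (P : Vk R k) :
  mpoly_of_dhomog (rho (SU2_inv (SU2_mul x y)) P) =
  comp_mpoly (subst_mx (SU2_mx y)) (mpoly_of_dhomog (rho (SU2_inv x) P)).
Proof.
by rewrite [LHS]/= [in RHS]/= subst_mx_comp !invmxK.
Qed.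

(** The inverse inside [rho] cancels against [SU2_inv]: along x exp(t X_i), the matrix exp(t X_i)
    itself is substituted into rho(x^-1) P. Hence no minus sign. *)
Lemma lieD_rho k (f : {linear Vk R k -> R[i]^o}) (P : Vk R k) i (x : SU2 R) :
  lieD (X i) (fun y => f (rho (SU2_inv y) P)) x =
  f (der (su2_mx (X i)) (rho (SU2_inv x) P)).
Proof.
apply: cdiff0_derive; apply: cdiff0_linear.
under eq_fun do rewrite rho_inv_mul SU2_expE -[X in rot_mx _ X]mul1r.
by rewrite -[der _ _]scale1r -[1 in X in X *: _]/(1%:C); exact: pdiff0_rot.
Qed.

End OneParameterSubgroups.

Section Equivariance.
Context (R : realType) (a b c : R) (k : nat).
Context (phi : 'Hom(Vk R k, 'Hom(Vk R k, R[i]^o))).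
Hypothesis equivariant :
  forall (x : SU2 R) (P Q : Vk R k), phi (rho x P) Q = phi P (rho (SU2_inv x) Q).
Local Notation X := (frame a b c).

Definition ev_at (Q : Vk R k) (P : Vk R k) : R[i]^o := phi P Q.

Fact ev_at_linear Q : linear (ev_at Q).
Proof. by move=> y P P'; rewrite /ev_at linearP add_lfunE scale_lfunE. Qed.

HB.instance Definition _ Q :=
  GRing.isLinear.Build R[i] (Vk R k) R[i]^o _ (ev_at Q) (ev_at_linear Q).

(** Both sides of equivariance at exp(t X_i) are differentiated at t = 0. The left side involves
    exp(-t X_i), the right side exp(t X_i); uniqueness of the derivative gives the skewness. *)
Lemma der_equivariant i (P Q : Vk R k) :
  phi P (der (su2_mx (X i)) Q) = - phi (der (su2_mx (X i)) P) Q.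
Proof.
have hl : cdiff0 (fun t => phi (rho (SU2_exp (su2_scale t (X i))) P) Q : R[i])
    (ev_at Q ((- 1)%:C *: der (su2_mx (X i)) P)).
  apply: (@cdiff0_linear _ _ (ev_at Q)).
  have -> : (fun t => mpoly_of_dhomog (rho (SU2_exp (su2_scale t (X i))) P)) =
      (fun t => comp_mpoly (subst_mx (rot_mx (par a b c i) (-1 * t) i)) (mpoly_of_dhomog P)).
    by apply/funext => t; rewrite mulN1r -SU2_exp_invE.
  exact: pdiff0_rot.
have hr : cdiff0 (fun t => phi P (rho (SU2_inv (SU2_exp (su2_scale t (X i)))) Q) : R[i])
    (phi P (1%:C *: der (su2_mx (X i)) Q)).
  apply: (@cdiff0_linear _ _ (phi P)).
  have -> : (fun t => mpoly_of_dhomog (rho (SU2_inv (SU2_exp (su2_scale t (X i)))) Q)) =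
      (fun t => comp_mpoly (subst_mx (rot_mx (par a b c i) (1 * t) i)) (mpoly_of_dhomog Q)).
    by apply/funext => t; rewrite mul1r -SU2_expE -SU2_invK.
  exact: pdiff0_rot.
have := cdiff0_unique hl; under eq_fun do rewrite equivariant.
by move=> /(_ _ hr); rewrite rmorphN rmorph1 scaleN1r scale1r linearN => <-.
Qed.

End Equivariance.

(** * The Hodge Laplacian on matrix coefficients *)

Section ThreeIndices.

Lemma ord3_ind (P : 'I_3 -> Prop) : P 0 -> P 1 -> P 2 -> forall i, P i.
Proof.
move=> P0 P1 P2; case=> [[|[|[|i]]] hi] //.
- by have -> : Ordinal hi = 0 by apply/val_inj.
- by have -> : Ordinal hi = 1 by apply/val_inj.
- by have -> : Ordinal hi = 2 by apply/val_inj.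
Qed.

Lemma sum3 (V : nmodType) (F : 'I_3 -> V) : \sum_i F i = F 0 + F 1 + F 2.
Proof.
rewrite !big_ord_recl big_ord0 addr0 addrA.
by congr (F _ + F _ + F _); apply/val_inj.
Qed.

Lemma shift3 : (((1 + 1)%R = 2 :> 'I_3) * ((1 + 2)%R = 0 :> 'I_3) *
  ((2 + 1)%R = 0 :> 'I_3) * ((2 + 2)%R = 1 :> 'I_3))%type.
Proof. by do !split; apply/val_inj. Qed.

End ThreeIndices.

(** * Exterior derivative and Hodge star in the frame *)

Section FrameCalculus.
Context (R : realType) (a b c : R).
Hypotheses (a0 : a != 0) (b0 : b != 0) (c0 : c != 0).
Local Notation X := (frame a b c).

(** Indices add modulo 3 in ['I_3]; the factor 2 is that of [E_(i+1), E_(i+2)] = 2 E_i. *)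
Definition struct3 (i : 'I_3) : R :=
  2 * par a b c (i + 1) * par a b c (i + 2) / par a b c i.

Lemma par_neq0 i : par a b c i != 0.
Proof. by elim/ord3_ind: i; rewrite /par (tnth_nth 0). Qed.

Lemma Emx_bracket (i : 'I_3) :
  Emx R (i + 1) *m Emx R (i + 2) - Emx R (i + 2) *m Emx R (i + 1) = 2 *: Emx R i.
Proof.
elim/ord3_ind: i; rewrite ?add0r ?shift3 /Emx !(tnth_nth 0).
all: apply: mx2_eqP; rewrite /= !mxE !big_ord_recl !big_ord0 !mxE /=.
all: by apply/eqP; rewrite eq_complex /=; apply/andP; split; apply/eqP; ring.
Qed.

Lemma frame_bracket (i : 'I_3) :
  su2_mx (su2_bracket (X (i + 1)) (X (i + 2))) = su2_mx (su2_scale (struct3 i) (X i)).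
Proof.
have -> : su2_mx (su2_scale (struct3 i) (X i)) =
    (par a b c (i + 1) * par a b c (i + 2))%:C *: (2 *: Emx R i).
  rewrite [LHS]scalerA scalerA; congr (_ *: _).
  have -> : (2 : R[i]) = (2 : R)%:C by rewrite rmorph_nat.
  rewrite -!rmorphM; congr (_%:C).
  by rewrite /struct3; field; exact: par_neq0.
rewrite -Emx_bracket scalerBr rmorphM; congr (_ - _).
  by rewrite -scalemxAl -scalemxAr scalerA.
by rewrite -scalemxAl -scalemxAr scalerA mulrC.
Qed.

Lemma dualE_scale (j : 'I_3) t (Y : su2 R) : dualE j (su2_scale t Y) = t * dualE j Y.
Proof.
rewrite /dualE; elim/ord3_ind: j; rewrite !(tnth_nth 0) /= !mxE.
all: by case: (su2_mx Y _ _) => y z /=; ring.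
Qed.

Lemma dual_frame_bracket (i j : 'I_3) :
  dual_frame a b c j (su2_bracket (X (i + 1)) (X (i + 2))) = struct3 i *+ (j == i).
Proof.
have -> : dual_frame a b c j (su2_bracket (X (i + 1)) (X (i + 2))) =
    dual_frame a b c j (su2_scale (struct3 i) (X i)).
  by rewrite /dual_frame /dualE frame_bracket.
by rewrite /dual_frame dualE_scale -mulrA -/(dual_frame _ _ _ _ _) dual_frameE // mulr_natr.
Qed.

Lemma dual_frame_bracketC (Y Z : su2 R) (j : 'I_3) :
  dual_frame a b c j (su2_bracket Z Y) = - dual_frame a b c j (su2_bracket Y Z).
Proof.
rewrite /dual_frame -mulNr; congr (_ / _).
have E : su2_mx (su2_bracket Z Y) = - su2_mx (su2_bracket Y Z) by rewrite /= opprB.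
rewrite /dualE E; move: (su2_mx (su2_bracket Y Z)) => M {E}.
by elim/ord3_ind: j; rewrite !(tnth_nth 0) /= !mxE; case: (M _ _).
Qed.

Lemma ev1_frame (w : form1 R) j : ev1 a b c w (X j) = (fun x => w x 0 j).
Proof.
apply/funext => x; rewrite /ev1 (bigD1 j) //= big1 => [|i ij].
  by rewrite dual_frameE // eqxx mul1r addr0.
by rewrite dual_frameE // (negPf ij) mul0r.
Qed.

Lemma ev1_bracket (w : form1 R) i x :
  ev1 a b c w (su2_bracket (X (i + 1)) (X (i + 2))) x = (struct3 i)%:C * w x 0 i.
Proof.
rewrite /ev1 (bigD1 i) //= big1 => [|j ji].
  by rewrite dual_frame_bracket eqxx mulr1n addr0.
by rewrite dual_frame_bracket (negPf ji) mulr0n mul0r.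
Qed.

Lemma ev1_bracketC (w : form1 R) (Y Z : su2 R) x :
  ev1 a b c w (su2_bracket Z Y) x = - ev1 a b c w (su2_bracket Y Z) x.
Proof.
rewrite /ev1 -sumrN; apply: eq_bigr => i _.
by rewrite dual_frame_bracketC rmorphN mulNr.
Qed.

Lemma eps3E (i j l : 'I_3) :
  eps3 R i j l = ((j == i + 1) && (l == i + 2))%:R - ((j == i + 2) && (l == i + 1))%:R.
Proof.
by elim/ord3_ind: i; elim/ord3_ind: j; elim/ord3_ind: l; rewrite /eps3 /= ?subrr ?subr0 ?sub0r.
Qed.

Lemma star1E (w : form1 R) x i j :
  star1 w x i j = w x 0 (i + 2) *+ (j == i + 1) - w x 0 (i + 1) *+ (j == i + 2).
Proof.
rewrite mxE sum3 !eps3E.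
by elim/ord3_ind: i; elim/ord3_ind: j; rewrite ?add0r ?shift3 /=; ring.
Qed.

Lemma star2E (h : form2 R) x l :
  star2 h x 0 l = 2^-1 * (h x (l + 1) (l + 2) - h x (l + 2) (l + 1)).
Proof.
rewrite mxE !sum3 !eps3E.
by elim/ord3_ind: l; rewrite ?add0r ?shift3 /=; congr (_ * _); ring.
Qed.

Lemma ev2_frame (h : form2 R) i j : ev2 a b c h (X i) (X j) = (fun x => h x i j).
Proof.
apply/funext => x; rewrite /ev2 (bigD1 i) //= [X in _ + X]big1 => [|l li].
  rewrite (bigD1 j) //= big1 => [|l lj].
    by rewrite !dual_frameE // !eqxx !mul1r !addr0.
  by rewrite !dual_frameE // (negPf lj) mulr0 mul0r.
by rewrite big1 // => m _; rewrite !dual_frameE // (negPf li) !mul0r.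
Qed.

Lemma ev2_bracket (h : form2 R) i j x :
  ev2 a b c h (su2_bracket (X (i + 1)) (X (i + 2))) (X j) x = (struct3 i)%:C * h x i j.
Proof.
rewrite /ev2 (bigD1 i) //= [X in _ + X]big1 => [|l li].
  rewrite (bigD1 j) //= big1 => [|l lj].
    by rewrite dual_frameE // dual_frame_bracket !eqxx mulr1 !addr0.
  by rewrite dual_frameE // (negPf lj) mulr0 mul0r.
by rewrite big1 // => m _; rewrite dual_frame_bracket (negPf li) !mul0r.
Qed.

Lemma ev2_bracketC (h : form2 R) (Y Z : su2 R) j x :
  ev2 a b c h (su2_bracket Z Y) (X j) x = - ev2 a b c h (su2_bracket Y Z) (X j) x.
Proof.
rewrite /ev2 -sumrN; apply: eq_bigr => i _.
rewrite -sumrN; apply: eq_bigr => l _.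
by rewrite dual_frame_bracketC rmorphN !mulNr.
Qed.

(** The matrix of [d1] is antisymmetric, so the two entries picked by the star coincide up to sign
    and cancel the factor 1/2. As [delta2] is again [star2] of [d1] of [star2], the second summand
    of [Delta1] is this operator applied twice. *)
Lemma star2_d1 (w : form1 R) x l :
  star2 (d1 a b c w) x 0 l =
    lieD (X (l + 1)) (fun y => w y 0 (l + 2)) x - lieD (X (l + 2)) (fun y => w y 0 (l + 1)) x
    - (struct3 l)%:C * w x 0 l.
Proof.
rewrite star2E !mxE !ev1_frame (ev1_bracketC _ (X (l + 1)) (X (l + 2))) ev1_bracket.
by field.
Qed.

End FrameCalculus.

(** * Gradient, codifferential and curl on matrix coefficients *)

Section InvariantForms.
Context (R : realType) (a b c : R) (k : nat).
Context (phi : 'Hom(Vk R k, 'Hom(Vk R k, R[i]^o))).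
Hypotheses (a0 : a != 0) (b0 : b != 0) (c0 : c != 0).
Hypothesis equivariant :
  forall (x : SU2 R) (P Q : Vk R k), phi (rho x P) Q = phi P (rho (SU2_inv x) Q).
Local Notation X := (frame a b c).

(* d rho_k (X_i); the sign comes from (rho x P)(u) = P(x^-1 u). *)
Definition drho (i : 'I_3) : Vk R k -> Vk R k := der (- su2_mx (X i)).

HB.instance Definition _ i := GRing.Linear.on (drho i).

Definition mcoef (v P : Vk R k) : form0 R := fun x => ev_at phi (rho (SU2_inv x) v) P.

Lemma mcoefD v P Q x : mcoef v (P + Q) x = mcoef v P x + mcoef v Q x.
Proof. exact: linearD. Qed.

Lemma mcoefB v P Q x : mcoef v (P - Q) x = mcoef v P x - mcoef v Q x.
Proof. exact: linearB. Qed.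

Lemma mcoefN v P x : mcoef v (- P) x = - mcoef v P x.
Proof. exact: linearN. Qed.

Lemma mcoefMn v P n x : mcoef v (P *+ n) x = mcoef v P x *+ n.
Proof. exact: linearMn. Qed.

Lemma mcoefZ v y P x : mcoef v (y *: P) x = y * mcoef v P x.
Proof. exact: linearZ. Qed.

Definition mcform (v : Vk R k) (t : tens R k) : form1 R :=
  fun x => \row_i mcoef v (t i) x.

Lemma lieD_mcoef v P i x : lieD (X i) (mcoef v P) x = mcoef v (drho i P) x.
Proof.
transitivity (phi P (der (su2_mx (X i)) (rho (SU2_inv x) v)) : R[i]).
  exact: (lieD_rho a b c (phi P)).
have -> : drho i P = - der (su2_mx (X i)) P.
  by rewrite /drho -[X in der X]scaleN1r derZ scaleN1r.
by rewrite der_equivariant // mcoefN.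
Qed.

Definition grad (P : Vk R k) : tens R k := [ffun i => drho i P].

Definition codiff (t : tens R k) : Vk R k := - \sum_i drho i (t i).

Definition curl (t : tens R k) : tens R k :=
  [ffun l => drho (l + 1) (t (l + 2)) - drho (l + 2) (t (l + 1))
             - (struct3 a b c l)%:C *: t l].

Lemma d0_mcoef v P x : d0 a b c (mcoef v P) x = mcform v (grad P) x.
Proof. by apply/rowP => i; rewrite !mxE lieD_mcoef ffunE. Qed.

Lemma star2_d1_mcform v t x : star2 (d1 a b c (mcform v t)) x = mcform v (curl t) x.
Proof.
have E i : (fun y => mcform v t y 0 i) = mcoef v (t i) by apply/funext => y; rewrite mxE.
apply/rowP => l; rewrite star2_d1 // !E !lieD_mcoef [mcform v t x 0 l]mxE [RHS]mxE ffunE.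
by rewrite !mcoefB mcoefZ.
Qed.

(** The bracket terms of [d2] drop out: [X_(i+1), X_(i+2)] is a multiple of X_i, and is paired with
    X_i in an antisymmetric form. Only the divergence remains. The bracket [X_0, X_2] is reversed to
    put it in cyclic order. *)
Lemma delta1_mcform v t x : delta1 a b c (mcform v t) x = mcoef v (codiff t) x.
Proof.
have E i (j : 'I_3) : (fun y => star1 (mcform v t) y i j) =
    mcoef v (t (i + 2) *+ (j == i + 1) - t (i + 1) *+ (j == i + 2)).
  apply/funext => y; rewrite star1E !mxE.
  by rewrite mcoefB !mcoefMn.
rewrite /delta1 /star3 /d2 !ev2_frame // (ev2_bracketC a b c _ (X 2) (X 0)).
have := ev2_bracket a0 b0 c0 (star1 (mcform v t)) 2 2 x; rewrite !shift3 => ->.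
have := ev2_bracket a0 b0 c0 (star1 (mcform v t)) 1 1 x; rewrite !shift3 => ->.
have := ev2_bracket a0 b0 c0 (star1 (mcform v t)) 0 0 x; rewrite !add0r => ->.
rewrite !E !lieD_mcoef !star1E !add0r !shift3 /=.
rewrite !(mulr0n, mulr1n, subr0, sub0r, mulr0, oppr0, addr0).
by rewrite /codiff sum3 !linearN mcoefN !mcoefD mcoefN opprK.
Qed.

Fact curl_linear : linear curl.
Proof.
move=> y s t; apply/ffunP => l; rewrite !ffunE !linearP !scalerDr /=.
by rewrite [X in X + _ = _]addrACA [LHS]addrACA.
Qed.

HB.instance Definition _ :=
  GRing.isLinear.Build R[i] (tens R k) (tens R k) _ curl curl_linear.

Fact grad_linear : linear grad.
Proof. by move=> y P Q; apply/ffunP => l; rewrite !ffunE linearP. Qed.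

HB.instance Definition _ :=
  GRing.isLinear.Build R[i] (Vk R k) (tens R k) _ grad grad_linear.

Fact codiff_linear : linear codiff.
Proof.
move=> y s t; rewrite /codiff scalerN -opprD scaler_sumr -big_split; congr (- _).
by apply: eq_bigr => i _; rewrite !ffunE linearP.
Qed.

HB.instance Definition _ :=
  GRing.isLinear.Build R[i] (tens R k) (Vk R k) _ codiff codiff_linear.

Definition Dt (t : tens R k) : tens R k := grad (codiff t) + curl (curl t).

Fact Dt_linear : linear Dt.
Proof. by move=> y s t; rewrite /Dt !linearP /= scalerDr addrACA. Qed.

HB.instance Definition _ :=
  GRing.isLinear.Build R[i] (tens R k) (tens R k) _ Dt Dt_linear.

Lemma Delta1_mcform v t : Delta1 a b c (mcform v t) =1 mcform v (Dt t).
Proof.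
move=> x; rewrite /Delta1 /delta2.
have -> : delta1 a b c (mcform v t) = mcoef v (codiff t).
  by apply/funext => y; exact: delta1_mcform.
have -> : star2 (d1 a b c (mcform v t)) = mcform v (curl t).
  by apply/funext => y; exact: star2_d1_mcform.
rewrite d0_mcoef star2_d1_mcform; apply/rowP => i; rewrite !mxE [in RHS]ffunE.
by rewrite mcoefD.
Qed.

Lemma tens_Hom_coord t v i : tens_Hom phi t v 0 i = phi (t i) v.
Proof. by rewrite lfunE /= lfunE /= mxE. Qed.

Lemma omega_tens_Hom v t : omega v (tens_Hom phi t) = mcform v t.
Proof. by apply/funext => x; apply/rowP => i; rewrite mxE; exact: tens_Hom_coord. Qed.

Hypothesis phi_bij : bijective phi.

Lemma tens_Hom_ker : lker (tens_Hom phi) == 0%VS.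
Proof.
apply/lker0P => s t st; apply/ffunP => i; apply: (bij_inj phi_bij); apply/lfunP => v.
have := congr1 (fun L : 'Hom(Vk R k, 'rV[R[i]]_3) => L v 0 i) st.
by rewrite !tens_Hom_coord.
Qed.

(** The property defining [Delta1_Hom] ranges over all [L], whereas [Dt] controls only those in the
    image of [tens_Hom phi]. *)
Lemma tens_Hom_surj (L : 'Hom(Vk R k, 'rV[R[i]]_3)) : exists t, L = tens_Hom phi t.
Proof.
have [psi _ phiK] := phi_bij.
have lin i : linear (fun v => L v 0 i : R[i]^o).
  by move=> y u v; rewrite linearP !mxE.
pose l i := GRing.isLinear.Build R[i] (Vk R k) R[i]^o _ _ (lin i).
pose F i : {linear Vk R k -> R[i]^o} := HB.pack (fun v => L v 0 i : R[i]^o) (l i).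
exists [ffun i => psi (linfun (F i))].
apply/lfunP => v; apply/rowP => i.
by rewrite tens_Hom_coord ffunE phiK lfunE.
Qed.

Lemma rho1 (x : SU2 R) (P : Vk R k) : SU2_mx x = 1%:M -> rho (SU2_inv x) P = P.
Proof.
move=> x1.
have E : subst_mx (SU2_mx (SU2_inv (SU2_inv x))) = [tuple mpolyX R[i] (mnm1 i) | i < 2].
  rewrite (SU2_invK x) x1; apply: eq_from_tnth => i.
  rewrite !tnth_mktuple (bigD1 i) //= big1 => [|j ji].
    by rewrite mxE eqxx scale1r addr0.
  by rewrite mxE eq_sym (negPf ji) scale0r.
apply/val_inj.
transitivity (comp_mpoly (subst_mx (SU2_mx (SU2_inv (SU2_inv x)))) (mpoly_of_dhomog P)).
  by [].
by rewrite E comp_mpoly_id.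
Qed.

Lemma Delta1_Hom_tens t : Delta1_Hom a b c k (tens_Hom phi t) = tens_Hom phi (Dt t).
Proof.
pose D0 : 'End('Hom(Vk R k, 'rV[R[i]]_3)) :=
  (tens_Hom phi \o linfun Dt \o (tens_Hom phi)^-1)%VF.
have D0E s : D0 (tens_Hom phi s) = tens_Hom phi (Dt s).
  rewrite /D0 !comp_lfunE lker0_lfunK ?tens_Hom_ker //.
  by congr (tens_Hom phi _); exact: lfunE.
have spec : [set D : 'End('Hom(Vk R k, 'rV[R[i]]_3)) |
    forall v L, Delta1 a b c (omega v L) =1 omega v (D L)]%classic D0.
  move=> v L; have [s ->] := tens_Hom_surj L.
  by rewrite D0E !omega_tens_Hom; exact: Delta1_mcform.
have := xgetI 0 spec; rewrite -/(Delta1_Hom a b c k) => H.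
(* The point exp(0) is the identity, where rho acts trivially. *)
apply/lfunP => v; pose e := SU2_exp (su2_scale 0 (X 0)).
have e1 : SU2_mx e = 1%:M by rewrite SU2_expE rot_mx0.
have := H v (tens_Hom phi t) e.
rewrite omega_tens_Hom Delta1_mcform -omega_tens_Hom /omega !rho1 //.
Qed.

Lemma Delta1_tensE t : Delta1_tens a b c phi t = Dt t.
Proof. by rewrite /Delta1_tens !comp_lfunE Delta1_Hom_tens lker0_lfunK ?tens_Hom_ker. Qed.

End InvariantForms.

(** * Weight blocks *)

Section LinearCombinations.
Context (F : comNzRingType) (V : lmodType F).

Inductive lexpr :=
  | LVar of nat | LZero | LAdd of lexpr & lexpr | LOpp of lexpr | LScale of F & lexpr.

Fixpoint leval (env : seq V) (e : lexpr) : V :=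
  match e with
  | LVar n => nth 0 env n
  | LZero => 0
  | LAdd e1 e2 => leval env e1 + leval env e2
  | LOpp e1 => - leval env e1
  | LScale y e1 => y *: leval env e1
  end.

Fixpoint lcoef (e : lexpr) (i : nat) : F :=
  match e with
  | LVar n => if Nat.eqb n i then 1 else 0
  | LZero => 0
  | LAdd e1 e2 => lcoef e1 i + lcoef e2 i
  | LOpp e1 => - lcoef e1 i
  | LScale y e1 => y * lcoef e1 i
  end.

Lemma leval_coef env e : leval env e = \sum_(i < size env) lcoef e i *: nth 0 env i.
Proof.
elim: e => [n||e1 h1 e2 h2|e1 h1|y e1 h1] /=.
- have E i : Nat.eqb n i = (n == i).
    by apply/idP/eqP => [/PeanoNat.Nat.eqb_eq|->] //; exact/PeanoNat.Nat.eqb_refl.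
  have [ns|sn] := ltnP n (size env); last first.
    rewrite nth_default // big1 // => i _; rewrite E.
    by case: eqP => [ni|_]; rewrite ?scale0r //; have := ltn_ord i; rewrite -ni ltnNge sn.
  rewrite (bigD1 (Ordinal ns)) //= E eqxx scale1r big1 ?addr0 // => i ni.
  by rewrite E; case: eqP => [nE|_]; rewrite ?scale0r //; case/eqP: ni; apply/val_inj.
- by rewrite big1 // => i _; rewrite scale0r.
- by rewrite h1 h2 -big_split; apply: eq_bigr => i _; rewrite scalerDl.
- by rewrite h1 -sumrN; apply: eq_bigr => i _; rewrite scaleNr.
- by rewrite h1 scaler_sumr; apply: eq_bigr => i _; rewrite scalerA.
Qed.

(** A recursive conjunction, so that [cbn] leaves one scalar equation per atom; [Nat.eqb] in [lcoef]
    computes for the same purpose. *)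
Fixpoint lagree (n : nat) (e1 e2 : lexpr) : Prop :=
  if n is n'.+1 then lcoef e1 n' = lcoef e2 n' /\ lagree n' e1 e2 else True.

Lemma leval_eq env e1 e2 : lagree (size env) e1 e2 -> leval env e1 = leval env e2.
Proof.
move=> h; rewrite !leval_coef; apply: eq_bigr => -[i /= hi] _; congr (_ *: _).
elim: (size env) hi h => // n IH; rewrite ltnS leq_eqVlt => /orP[/eqP ->|hi] [] //.
by move=> _ /(IH hi).
Qed.

End LinearCombinations.

Ltac lin_index u l :=
  lazymatch l with
  | u :: _ => constr:(O)
  | _ :: ?l' => let n := lin_index u l' in constr:(S n)
  end.

Ltac lin_atoms l e :=
  lazymatch e with
  | @Algebra.add _ ?x ?y => let l1 := lin_atoms l x in lin_atoms l1 y
  | @Algebra.opp _ ?x => lin_atoms l x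
  | @GRing.scale _ _ _ ?x => lin_atoms l x
  | @Algebra.zero _ => l
  | ?u => match l with
          (* If [u] is not yet listed, [lin_index] fails and matching backtracks to the branch that
             adds it. *)
          | _ => let n := lin_index u l in l
          | _ => constr:(u :: l)
          end
  end.

Ltac lin_quote F l e :=
  lazymatch e with
  | @Algebra.add _ ?x ?y =>
      let x' := lin_quote F l x in let y' := lin_quote F l y in constr:(@LAdd F x' y')
  | @Algebra.opp _ ?x => let x' := lin_quote F l x in constr:(@LOpp F x')
  | @GRing.scale _ _ ?c ?x => let x' := lin_quote F l x in constr:(@LScale F c x')
  | @Algebra.zero _ => constr:(@LZero F)
  | ?u => let n := lin_index u l in constr:(@LVar F n)
  end.

(* Reduces an equation between linear combinations in V to equations between
   the coefficients. *)
Ltac lin_coef F V :=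
  repeat match goal with |- context [Pl ?R ?k ?l] =>
    let u := fresh "u" in move: (Pl R k l) => u end;
  lazymatch goal with |- ?x = ?y =>
    let T := type of x in
    let l := lin_atoms (@nil V) x in let l := lin_atoms l y in
    let x' := lin_quote F l x in let y' := lin_quote F l y in
    refine (@leval_eq F V l x' y' _)
  end;
  cbn [lagree lcoef size Nat.eqb]; repeat apply: conj => //.


(** * The first-order operators on a block *)

Section Blocks.
Context (R : realType) (a b : R) (k : nat).
Hypotheses (a0 : a != 0) (b0 : b != 0).
Local Notation P := (@Pl R k).
Local Notation A := (a%:C).
Local Notation B := (b%:C).
Local Notation K := (k%:R : R[i]).
Local Notation I := ('i : R[i]).

Lemma mulii : I * I = - 1.
Proof. by apply/eqP; rewrite eq_complex /=; apply/andP; split; apply/eqP; ring. Qed.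

Lemma realC_neq0 (y : R) : y != 0 -> y%:C != 0 :> R[i].
Proof. by rewrite fmorph_eq0. Qed.

Lemma drho_mx2 (x y z t : R[i]) (i : 'I_3) (l : int) :
  - su2_mx (frame a b b i) = mx2 x y z t -> (0 <= l <= k%:Z) ->
  drho a b b i (P l) = (x * l%:~R + t * (K - l%:~R)) *: P l
    + (y * l%:~R) *: P (l - 1) + (z * (K - l%:~R)) *: P (l + 1).
Proof.
rewrite /drho => ->; case: l => // l; rewrite lez_nat /= => lk.
by rewrite der_mx2_Pl // natrB.
Qed.

Local Opaque Pl drho.

Lemma Pl_oob (l : int) : ~~ (0 <= l <= k%:Z) -> P l = 0.
Proof. by move=> h; apply: Pl_out; lia. Qed.

Lemma frame_mx i : su2_mx (frame a b b i) = (par a b b i)%:C *: Emx R i.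
Proof. by []. Qed.

Lemma drho0_Pl l : drho a b b 0 (P l) = (I * A * (K - 2 * l%:~R)) *: P l.
Proof.
have [lk|lk] := boolP (0 <= l <= k%:Z); last by rewrite Pl_oob // linear0 scaler0.
rewrite (@drho_mx2 (- (A * I)) 0 0 (A * I)) //.
  by lin_coef (R[i] : comNzRingType) (Vk R k : lmodType R[i]); ring.
rewrite frame_mx /par /Emx !(tnth_nth 0) /=.
by apply: mx2_eqP; rewrite !mxE /= ?mulr0 ?oppr0 // mulrN opprK.
Qed.

(** Without the side condition the formula fails at l = -1 and l = k+1: P_l is 0, but the right side
    retains a multiple of P_0 or P_k. Carrying the scalar [z] lets a zero coefficient excuse such an
    index. The diagonal [drho0_Pl] has no such exception. *)
Lemma drho1_Pl (z : R[i]) (l : int) : (z == 0) || (0 <= l <= k%:Z) ->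
  z *: drho a b b 1 (P l) = (- (z * B * l%:~R)) *: P (l - 1)
    + (z * B * (K - l%:~R)) *: P (l + 1).
Proof.
have [->|_] := eqVneq z 0; first by rewrite !mul0r oppr0 !scale0r addr0.
move=> /= lk; rewrite (@drho_mx2 0 (- B) B 0) //.
  by lin_coef (R[i] : comNzRingType) (Vk R k : lmodType R[i]); ring.
rewrite frame_mx /par /Emx !(tnth_nth 0) /=.
by apply: mx2_eqP; rewrite !mxE /= ?mulr0 ?oppr0 ?mulr1 // mulrN1 opprK.
Qed.

Lemma drho2_Pl (z : R[i]) (l : int) : (z == 0) || (0 <= l <= k%:Z) ->
  z *: drho a b b 2 (P l) = (- (z * B * I * l%:~R)) *: P (l - 1)
    - (z * B * I * (K - l%:~R)) *: P (l + 1).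
Proof.
have [->|_] := eqVneq z 0; first by rewrite !mul0r oppr0 !scale0r subr0.
move=> /= lk; rewrite (@drho_mx2 0 (- (B * I)) (- (B * I)) 0) //.
  by lin_coef (R[i] : comNzRingType) (Vk R k : lmodType R[i]); ring.
rewrite frame_mx /par /Emx !(tnth_nth 0) /=.
by apply: mx2_eqP; rewrite !mxE /= ?mulr0 ?oppr0.
Qed.

(** A weight space of E_1, of weight (k - 2j) i: P_l has weight (k - 2l) i, and the dual vectors X_2
    + i X_3 and X_2 - i X_3 have weights -2i and 2i. Since b = c, right translations by exp(t E_1)
    are isometries, which is why the operators preserve it. *)
Definition block (j : int) (p q r : R[i]) : tens R k :=
  p *: tensor (P (j - 1)) (dualX R 1 + I *: dualX R 2) + q *: tensor (P j) (dualX R 0)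
  + r *: tensor (P (j + 1)) (dualX R 1 - I *: dualX R 2).

Local Notation blk := block.

Lemma blk0E j p q r : blk j p q r 0 = q *: P j.
Proof.
rewrite !ffunE !mxE !eqxx /=.
by lin_coef (R[i] : comNzRingType) (Vk R k : lmodType R[i]); ring.
Qed.

Lemma blk1E j p q r : blk j p q r 1 = p *: P (j - 1) + r *: P (j + 1).
Proof.
rewrite !ffunE !mxE !eqxx /=.
by lin_coef (R[i] : comNzRingType) (Vk R k : lmodType R[i]); ring.
Qed.

Lemma blk2E j p q r : blk j p q r 2 = (I * p) *: P (j - 1) + (- (I * r)) *: P (j + 1).
Proof.
rewrite !ffunE !mxE !eqxx /=.
by lin_coef (R[i] : comNzRingType) (Vk R k : lmodType R[i]); ring.
Qed.

Lemma blk_ext j p q r p' q' r' : p = p' -> q = q' -> r = r' ->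
  blk j p q r = blk j p' q' r'.
Proof. by move=> -> -> ->. Qed.

Lemma blkZ (z : R[i]) j p q r : z *: blk j p q r = blk j (z * p) (z * q) (z * r).
Proof. by rewrite /block !scalerDr !scalerA. Qed.

Lemma blkD j p q r p' q' r' :
  blk j p q r + blk j p' q' r' = blk j (p + p') (q + q') (r + r').
Proof.
rewrite /block; move: (tensor _ _) (tensor _ _) (tensor _ _) => t0 t1 t2.
by lin_coef (R[i] : comNzRingType) (tens R k : lmodType R[i]); ring.
Qed.

Lemma blk_zero j : blk j 0 0 0 = 0.
Proof. by rewrite /block !scale0r !addr0. Qed.

Lemma struct3_abb : ((struct3 a b b 0 = (2 * b ^+ 2 / a)%R) *
  (struct3 a b b 1 = (2 * a)%R) * (struct3 a b b 2 = (2 * a)%R))%type.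
Proof.
by rewrite /struct3 /par !add0r !shift3 !(tnth_nth 0) /=; do !split; field; rewrite ?a0 ?b0.
Qed.

Lemma intr_pred (l : int) : (l - 1)%:~R = l%:~R - 1 :> R[i].
Proof. exact: rmorphB. Qed.

Lemma intr_succ (l : int) : (l + 1)%:~R = l%:~R + 1 :> R[i].
Proof. exact: rmorphD. Qed.

Lemma drho_comb1 i (z : R[i]) (u : Vk R k) : drho a b b i (z *: u) = z *: drho a b b i u.
Proof. exact: linearZ. Qed.

Lemma drho_comb2 i (y z : R[i]) (u v : Vk R k) :
  drho a b b i (y *: u + z *: v) = y *: drho a b b i u + z *: drho a b b i v.
Proof. by rewrite linearP linearZ. Qed.

Lemma mulI_supported (z : R[i]) (h : bool) : (z == 0) || h -> (I * z == 0) || h.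
Proof. by case/orP => [/eqP ->|->]; rewrite ?mulr0 ?eqxx ?orbT. Qed.

Lemma mulNI_supported (z : R[i]) (h : bool) : (z == 0) || h -> (- (I * z) == 0) || h.
Proof. by rewrite oppr_eq0; exact: mulI_supported. Qed.

(* The side conditions say that the coefficients of the vanishing P_l are 0. *)
Definition supported (j : int) (p q r : R[i]) : bool :=
  [&& (p == 0) || (0 <= j - 1 <= k%:Z), (q == 0) || (0 <= j <= k%:Z)
    & (r == 0) || (0 <= j + 1 <= k%:Z)].

Lemma curl_blk j p q r : supported j p q r ->
  curl a b b (blk j p q r) =
  blk j (A * (K - 2 * j%:~R) * p - I * B * j%:~R * q)
    (2 * I * B * ((K - j%:~R + 1) * p + (j%:~R + 1) * r) - 2 * B ^+ 2 / A * q)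
    (- (I * B * (K - j%:~R) * q) - A * (K - 2 * j%:~R) * r).
Proof.
move=> /and3P[hp hq hr].
have A0 := realC_neq0 a0.
apply/ffunP; elim/ord3_ind; rewrite ffunE ?add0r ?shift3 ?blk0E ?blk1E ?blk2E struct3_abb.
- rewrite 2!drho_comb2 (drho1_Pl (mulI_supported hp)) (drho1_Pl (mulNI_supported hr)).
  rewrite (drho2_Pl hp) (drho2_Pl hr) (subrK 1 j) (addrK 1 j) (intr_pred j) (intr_succ j).
  rewrite [(_ / _)%:C]rmorphM fmorphV rmorphM rmorphXn rmorph_nat.
  by lin_coef (R[i] : comNzRingType) (Vk R k : lmodType R[i]); field: mulii.
- rewrite drho_comb1 drho_comb2 (drho2_Pl hq) 2!drho0_Pl rmorphM rmorph_nat.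
  rewrite (intr_pred j) (intr_succ j).
  by lin_coef (R[i] : comNzRingType) (Vk R k : lmodType R[i]); ring: mulii.
- rewrite drho_comb1 drho_comb2 (drho1_Pl hq) 2!drho0_Pl rmorphM rmorph_nat.
  rewrite (intr_pred j) (intr_succ j).
  by lin_coef (R[i] : comNzRingType) (Vk R k : lmodType R[i]); ring: mulii.
Qed.

Lemma codiff_blk j p q r : supported j p q r ->
  codiff a b b (blk j p q r) =
  - (I * A * (K - 2 * j%:~R) * q
     + 2 * B * ((K - j%:~R + 1) * p - (j%:~R + 1) * r)) *: P j.
Proof.
move=> /and3P[hp hq hr].
rewrite /codiff sum3 blk0E blk1E blk2E drho_comb1 2!drho_comb2 drho0_Pl.
rewrite (drho1_Pl hp) (drho1_Pl hr) (drho2_Pl (mulI_supported hp)).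
rewrite (drho2_Pl (mulNI_supported hr)) (subrK 1 j) (addrK 1 j) (intr_pred j) (intr_succ j).
by lin_coef (R[i] : comNzRingType) (Vk R k : lmodType R[i]); ring: mulii.
Qed.

Lemma grad_Pl (j : int) : 0 <= j <= k%:Z ->
  grad a b b (P j) = blk j (- (B * j%:~R)) (I * A * (K - 2 * j%:~R)) (B * (K - j%:~R)).
Proof.
move=> hj; have h1 : (1 == 0 :> R[i]) || (0 <= j <= k%:Z) by rewrite hj orbT.
apply/ffunP; elim/ord3_ind; rewrite ffunE ?blk0E ?blk1E ?blk2E.
- by rewrite drho0_Pl.
- by rewrite -[LHS]scale1r drho1_Pl // !mul1r.
- by rewrite -[LHS]scale1r drho2_Pl //;
    lin_coef (R[i] : comNzRingType) (Vk R k : lmodType R[i]); ring.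
Qed.

Lemma Dt_curl_eigen (t : tens R k) (y : R) : codiff a b b t = 0 -> curl a b b t = y%:C *: t ->
  Dt a b b t = (y ^+ 2)%:C *: t.
Proof.
by move=> d0 ce; rewrite /Dt d0 linear0 add0r ce linearZ /= ce scalerA -rmorphM.
Qed.

End Blocks.

(** * The eigenvalue equations *)

Section Eigen.
Context (R : realType) (a b : R) (k : nat).
Hypotheses (a_gt0 : 0 < a) (b_gt0 : 0 < b) (k_ge2 : (2 <= k)%N).
Local Notation A := (a%:C).
Local Notation B := (b%:C).
Local Notation K := (k%:R : R).
Local Notation I := ('i : R[i]).
Local Notation blk := (@block R k).

Let a0 : a != 0. Proof. by rewrite gt_eqF. Qed.
Let b0 : b != 0. Proof. by rewrite gt_eqF. Qed.

(* The factors 'i make the matrix of curl on a block real. *)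
Lemma curl_blk_real (j : int) (p q r : R) :
  supported k j (I * p%:C) q%:C (I * r%:C) ->
  let J : R := j%:~R in
  curl a b b (blk j (I * p%:C) q%:C (I * r%:C)) =
  blk j (I * (a * (K - 2 * J) * p - b * J * q)%:C)
    (- (2 * b * ((K - J + 1) * p + (J + 1) * r)) - 2 * b ^+ 2 / a * q)%:C
    (I * (- (b * (K - J) * q) - a * (K - 2 * J) * r)%:C).
Proof.
move=> hs J; rewrite curl_blk //.
have -> : j%:~R = J%:C :> R[i] by rewrite rmorph_int.
have -> : k%:R = K%:C :> R[i] by rewrite rmorph_nat.
have A0 := realC_neq0 a0.
by apply: blk_ext; [ring|field: (mulii R)|ring].
Qed.

Lemma codiff_blk_real (j : int) (p q r : R) :
  supported k j (I * p%:C) q%:C (I * r%:C) ->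
  let J : R := j%:~R in
  codiff a b b (blk j (I * p%:C) q%:C (I * r%:C)) =
  - (I * (a * (K - 2 * J) * q + 2 * b * ((K - J + 1) * p - (J + 1) * r))%:C) *: Pl R k j.
Proof.
move=> hs J; rewrite codiff_blk //; congr (- _ *: _).
have -> : j%:~R = J%:C :> R[i] by rewrite rmorph_int.
have -> : k%:R = K%:C :> R[i] by rewrite rmorph_nat.
ring.
Qed.

Lemma Dt_blk_eigen (j : int) (p q r y : R) :
  supported k j (I * p%:C) q%:C (I * r%:C) ->
  let J : R := j%:~R in
  a * (K - 2 * J) * p - b * J * q = y * p ->
  - (2 * b * ((K - J + 1) * p + (J + 1) * r)) - 2 * b ^+ 2 / a * q = y * q ->
  - (b * (K - J) * q) - a * (K - 2 * J) * r = y * r ->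
  a * (K - 2 * J) * q + 2 * b * ((K - J + 1) * p - (J + 1) * r) = 0 ->
  Dt a b b (blk j (I * p%:C) q%:C (I * r%:C)) =
  (y ^+ 2)%:C *: blk j (I * p%:C) q%:C (I * r%:C).
Proof.
move=> hs J hp hq hr hd; apply: Dt_curl_eigen.
  by rewrite codiff_blk_real // hd rmorph0 mulr0 oppr0 scale0r.
rewrite curl_blk_real // hp hq hr blkZ !rmorphM.
by apply: blk_ext; ring.
Qed.


Lemma v_E j : v_ a b k j =
  blk j%:Z (I * (j%:R * (b / a))%:C) (K - 2 * j%:R)%:C (I * (- ((K - j%:R) * (b / a)))%:C).
Proof.
rewrite /v_ /block; move: (tensor _ _) (tensor _ _) (tensor _ _) => t0 t1 t2.
by lin_coef (R[i] : comNzRingType) (tens R k : lmodType R[i]); ring.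
Qed.

Lemma w_m1E : w_m1 R k = blk (-1) 0 0 1.
Proof. by rewrite /w_m1 /block !scale0r !add0r scale1r addNr. Qed.

Lemma w_k1E : w_k1 R k = blk (k%:Z + 1) 1 0 0.
Proof. by rewrite /w_k1 /block !scale0r !addr0 scale1r addrK. Qed.

Lemma w_0E : w_0 a b k = blk 0 (I * 0%:C) (2 * (b / a))%:C (I * K%:C).
Proof. by rewrite /w_0 /block rmorph0 mulr0 scale0r !add0r. Qed.

Lemma w_kE : w_k a b k = blk k%:Z (I * K%:C) (2 * (b / a))%:C (I * 0%:C).
Proof. by rewrite /w_k /block rmorph0 mulr0 scale0r !addr0. Qed.

Lemma w_pmE s j : w_pm a b k s j =
  blk j%:Z (I * (alpha a b k s j)%:C) (beta a b k s j)%:C (I * (K - j%:R)%:C).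
Proof. by []. Qed.


Lemma supported_real (j : int) (p q r : R) :
  (p == 0) || (0 <= j - 1 <= k%:Z) -> (q == 0) || (0 <= j <= k%:Z) ->
  (r == 0) || (0 <= j + 1 <= k%:Z) ->
  supported k j (I * p%:C) q%:C (I * r%:C).
Proof.
have I0 : I != 0 by rewrite eq_complex /= oner_eq0 andbF.
by move=> hp hq hr; rewrite /supported !mulf_eq0 !fmorph_eq0 (negPf I0) /= hp hq hr.
Qed.

Lemma Dt_v j : (j <= k)%N -> Dt a b b (v_ a b k j) = (nu a b k j)%:C *: v_ a b k j.
Proof.
move=> jk.
have hs : supported k j%:Z (I * (j%:R * (b / a))%:C) (K - 2 * j%:R)%:C
    (I * (- ((K - j%:R) * (b / a)))%:C).
  (* The coefficients j and k - j vanish exactly at the ends j = 0 and j = k, where P_(j-1) and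
     P_(j+1) do. *)
  apply: supported_real; last 1 first.
  - have [->|jk'] := eqVneq j k; first by rewrite subrr mul0r oppr0 eqxx.
    by apply/orP; right; lia.
  - by case: j jk => [|j] jk; rewrite ?mul0r ?eqxx //; apply/orP; right; lia.
  - by apply/orP; right; lia.
rewrite /Dt v_E curl_blk_real // codiff_blk_real //.
rewrite (_ : a * (K - 2 * _) * _ - _ = 0); last by field.
rewrite (_ : - (2 * b * _) - _ = 0); last by field.
rewrite (_ : - (b * _ * _) - _ = 0); last by field.
rewrite rmorph0 mulr0 blk_zero linear0 addr0 linearZ /=.
(* The codifferential of v_j is -(i nu_j / a) P_j, while grad P_j = i a v_j. *)
rewrite (_ : a * (K - 2 * _) * _ + _ = nu a b k j / a); last by rewrite /nu; field.
rewrite grad_Pl; last by lia.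
rewrite !blkZ; apply: blk_ext; field: (mulii R).
all: by rewrite ?fmorph_eq0.
Qed.

Lemma Dt_w_m1 : Dt a b b (w_m1 R k) = (mu_m1 a k)%:C *: w_m1 R k.
Proof.
have hs : supported k (-1) (0 : R[i]) 0 1.
  by apply/and3P; split; apply/orP; [left|left|right]; rewrite ?eqxx //; lia.
(* The base of the square is the curl eigenvalue, read off the only nonzero coefficient of this
   block. *)
have -> : mu_m1 a k = (- ((K + 2) * a)) ^+ 2 by rewrite /mu_m1; ring.
apply: Dt_curl_eigen.
  by rewrite w_m1E codiff_blk //= !(mulr0, mulr1, addr0, sub0r, addNr, oppr0, scale0r).
rewrite w_m1E curl_blk // blkZ.
apply: blk_ext; ring.
Qed.

Lemma Dt_w_k1 : Dt a b b (w_k1 R k) = (mu_m1 a k)%:C *: w_k1 R k.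
Proof.
have hs : supported k (k%:Z + 1) (1 : R[i]) 0 0.
  by apply/and3P; split; apply/orP; [right|left|left]; rewrite ?eqxx //; lia.
have kE : (k%:Z + 1)%:~R = k%:R + 1 :> R[i] by rewrite rmorphD.
have -> : mu_m1 a k = (- ((K + 2) * a)) ^+ 2 by rewrite /mu_m1; ring.
apply: Dt_curl_eigen.
  rewrite w_k1E codiff_blk // kE (_ : - _ = 0) ?scale0r //; ring.
rewrite w_k1E curl_blk // kE blkZ.
apply: blk_ext; ring.
Qed.

(** At j = 0 and j = k the radicand is a perfect square, S_j = a^2 k + b^2, and the curl eigenvalue
    -(b^2 + S_j)/a becomes -(a k + 2 b^2/a). *)
Lemma Dt_w_0 : Dt a b b (w_0 a b k) = (mu_0 a b k)%:C *: w_0 a b k.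
Proof.
have -> : mu_0 a b k = (- (a * K + 2 * (b ^+ 2 / a))) ^+ 2 by rewrite /mu_0; field.
have hs : supported k 0 (I * 0%:C) (2 * (b / a))%:C (I * K%:C).
  by apply: supported_real; rewrite ?eqxx //; apply/orP; right; lia.
rewrite w_0E (Dt_blk_eigen (y := - (a * K + 2 * (b ^+ 2 / a))) hs) // mulr0z.
all: by field.
Qed.

Lemma Dt_w_k : Dt a b b (w_k a b k) = (mu_0 a b k)%:C *: w_k a b k.
Proof.
have -> : mu_0 a b k = (- (a * K + 2 * (b ^+ 2 / a))) ^+ 2 by rewrite /mu_0; field.
have hs : supported k k%:Z (I * K%:C) (2 * (b / a))%:C (I * 0%:C).
  by apply: supported_real; rewrite ?eqxx //; apply/orP; right; lia.
rewrite w_kE (Dt_blk_eigen (y := - (a * K + 2 * (b ^+ 2 / a))) hs) //.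
all: rewrite -[k%:Z%:~R]/(k%:R : R); by field.
Qed.

(** Identifies the radicand in [mu_pm] with the one in [S_]. *)
Lemma S_nu j : a ^+ 2 * nu a b k j + b ^+ 4 = a ^+ 4 * (K - 2 * j%:R) ^+ 2
  + a ^+ 2 * b ^+ 2 * (2 * K + 4 * j%:R * (K - j%:R)) + b ^+ 4.
Proof. by rewrite /nu; ring. Qed.

Lemma nu_gt0 j : (j <= k)%N -> 0 < nu a b k j.
Proof.
move=> jk; have jK : 0 <= K - j%:R by rewrite subr_ge0 ler_nat.
have -> : nu a b k j = a ^+ 2 * (K - 2 * j%:R) ^+ 2
    + b ^+ 2 * (4 * j%:R * (K - j%:R)) + b ^+ 2 * (2 * K) by rewrite /nu; ring.
apply: ltr_wpDl.
  apply: addr_ge0; first by rewrite mulr_ge0 ?sqr_ge0.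
  by apply: mulr_ge0; [exact: sqr_ge0|apply: mulr_ge0 => //; rewrite mulr_ge0].
by rewrite !mulr_gt0 ?exprn_gt0 ?ltr0n //; lia.
Qed.

Lemma S_gt0 j : (j <= k)%N -> 0 < S_ a b k j.
Proof.
move=> jk; rewrite sqrtr_gt0 -S_nu; apply: ltr_wpDl; last by rewrite exprn_gt0.
by rewrite mulr_ge0 ?sqr_ge0 // ltW // nu_gt0.
Qed.

Lemma S_sqr j : (j <= k)%N -> S_ a b k j ^+ 2 = a ^+ 4 * (K - 2 * j%:R) ^+ 2
  + a ^+ 2 * b ^+ 2 * (2 * K + 4 * j%:R * (K - j%:R)) + b ^+ 4.
Proof. by move=> jk; rewrite sqr_sqrtr // ltW // -sqrtr_gt0; exact: S_gt0. Qed.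

(* The eigenvalue of the curl is -(b^2 + T) / a, where T = +-S_j. *)
Lemma w_pm_system (J T : R) : K - J + 1 != 0 ->
  T ^+ 2 = a ^+ 4 * (K - 2 * J) ^+ 2
    + a ^+ 2 * b ^+ 2 * (2 * K + 4 * J * (K - J)) + b ^+ 4 ->
  let al := (2 * (K - 2 * J) ^+ 2 * a ^+ 2 + (2 * K + 4 * J * (K - J)) * b ^+ 2
             - 2 * (K - 2 * J) * T) / (4 * (K - J + 1) * b ^+ 2) in
  let be := (- a ^+ 2 * (K - 2 * J) + b ^+ 2 + T) / (a * b) in
  let y := - ((b ^+ 2 + T) / a) in
  [/\ a * (K - 2 * J) * al - b * J * be = y * al,
    - (2 * b * ((K - J + 1) * al + (J + 1) * (K - J))) - 2 * b ^+ 2 / a * be = y * be,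
    - (b * (K - J) * be) - a * (K - 2 * J) * (K - J) = y * (K - J)
    & a * (K - 2 * J) * be + 2 * b * ((K - J + 1) * al - (J + 1) * (K - J)) = 0].
Proof.
move: K => k' n0 T2 al be y; rewrite /al /be /y; split.
- by field: T2; rewrite ?a0 ?b0 ?n0.
- by field: T2; rewrite ?a0 ?b0 ?n0.
- by field; rewrite ?a0 ?b0 ?n0.
- by field: T2; rewrite ?a0 ?b0 ?n0.
Qed.

Lemma Dt_w_pm s j : s ^+ 2 = 1 -> (1 <= j <= k.-1)%N ->
  Dt a b b (w_pm a b k s j) = (mu_pm a b k s j)%:C *: w_pm a b k s j.
Proof.
move=> s2 jk.
have jk' : (j <= k)%N by lia.
have S2 := S_sqr jk'.
have -> : mu_pm a b k s j = (- ((b ^+ 2 + s * S_ a b k j) / a)) ^+ 2.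
  rewrite /mu_pm S_nu -/(S_ a b k j).
  have := S_nu j; rewrite -S2; move: (S_ a b k j) (nu a b k j) => S n hn.
  have -> : n = (S ^+ 2 - b ^+ 4) / a ^+ 2 by rewrite -hn; field.
  (* With S^2 = a^2 nu + b^4 and s^2 = 1, the square ((b^2 + s S)/a)^2 expands to [mu_pm]. *)
  by field: s2.
have n0 : K - j%:R + 1 != 0.
  by rewrite -natrB 1?natr1 ?pnatr_eq0 //; lia.
have T2 : (s * S_ a b k j) ^+ 2 = a ^+ 4 * (K - 2 * j%:R) ^+ 2
  + a ^+ 2 * b ^+ 2 * (2 * K + 4 * j%:R * (K - j%:R)) + b ^+ 4.
  by rewrite exprMn s2 mul1r.
have [] := w_pm_system n0 T2.
rewrite -[2 * (K - 2 * _) * (s * _)]mulrCA => e1 e2 e3 e4.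
have hs : supported k j%:Z (I * (alpha a b k s j)%:C) (beta a b k s j)%:C (I * (K - j%:R)%:C).
  by apply: supported_real; apply/orP; right; lia.
exact: (Dt_blk_eigen hs e1 e2 e3 e4).
Qed.

End Eigen.

(** * The basis *)

Lemma mem_seq4 (T : eqType) (x y z t : T) : let s := [:: x; y; z; t] in
  [/\ x \in s, y \in s, z \in s & t \in s].
Proof. by rewrite /= !inE !eqxx !orbT. Qed.

Section Basis.
Context (R : realType) (a b : R) (k : nat).
Hypotheses (a_gt0 : 0 < a) (b_gt0 : 0 < b) (k_ge2 : (2 <= k)%N).
Local Notation K := (k%:R : R).
Local Notation I := ('i : R[i]).
Local Notation blk := (@block R k).

Let a0 : a != 0. Proof. by rewrite gt_eqF. Qed.
Let b0 : b != 0. Proof. by rewrite gt_eqF. Qed.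
Let I0 : I != 0. Proof. by rewrite eq_complex /= oner_eq0 andbF. Qed.

Lemma blk_comb j p q r :
  blk j p q r = p *: blk j 1 0 0 + q *: blk j 0 1 0 + r *: blk j 0 0 1.
Proof.
rewrite /block; move: (tensor _ _) (tensor _ _) (tensor _ _) => t0 t1 t2.
by lin_coef (R[i] : comNzRingType) (tens R k : lmodType R[i]); ring.
Qed.

(** Both w^+ - w^- and v + (b/a) w^+ have no P_(j+1) component. This is, up to a factor i, the
    determinant of their two remaining coordinates; it equals -S_j nu_j / (a^2 b^2 (k-j+1)). *)
Lemma w_pm_det j : (j <= k)%N ->
  (alpha a b k 1 j - alpha a b k (-1) j) * (K - 2 * j%:R + b / a * beta a b k 1 j)
  - (beta a b k 1 j - beta a b k (-1) j) * (j%:R * (b / a) + b / a * alpha a b k 1 j) != 0.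
Proof.
move=> jk.
have n_gt : 0 < K - j%:R + 1 by rewrite -natrB // natr1 ltr0n.
have n0 : K - j%:R + 1 != 0 by rewrite gt_eqF.
have := S_gt0 a_gt0 b_gt0 k_ge2 jk; have := nu_gt0 a_gt0 b_gt0 k_ge2 jk; rewrite /alpha /beta.
move=> n_gt0 S_gt0'.
rewrite [X in X != 0](_ : _ =
    - (S_ a b k j * nu a b k j / (a ^+ 2 * b ^+ 2 * (K - j%:R + 1)))).
  by rewrite oppr_eq0 gt_eqF // divr_gt0 ?mulr_gt0 ?exprn_gt0.
by rewrite /nu; field; rewrite ?a0 ?b0 ?n0.
Qed.

Lemma blk_comb2 j p q r : r = 0 -> blk j p q r = p *: blk j 1 0 0 + q *: blk j 0 1 0.
Proof. by move=> ->; rewrite blk_comb scale0r addr0. Qed.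

(** * Spanning, block by block *)

Section Span.
(* A bare predicate instead of a {vspace _}, to keep conversion problems small. *)
Variable S : tens R k -> Prop.
Hypotheses (S_Z : forall (z : R[i]) (t : tens R k), S t -> S (z *: t))
  (S_D : forall s t : tens R k, S s -> S t -> S (s + t)).
Hypotheses (S_v : forall j, (j <= k)%N -> S (v_ a b k j))
  (S_w_m1 : S (w_m1 R k)) (S_w_0 : S (w_0 a b k))
  (S_w_k : S (w_k a b k)) (S_w_k1 : S (w_k1 R k))
  (S_w_pm : forall j, (1 <= j <= k.-1)%N ->
    S (w_pm a b k 1 j) /\ S (w_pm a b k (-1) j)).

Lemma span_det2 (x y : tens R k) (p q r s : R[i]) :
  S (p *: x + q *: y) -> S (r *: x + s *: y) -> p * s - q * r != 0 ->
  S x /\ S y.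
Proof.
move=> h1 h2 d0; split.
  have -> : x = (p * s - q * r)^-1 *: (s *: (p *: x + q *: y) + (- q) *: (r *: x + s *: y)).
    by lin_coef (R[i] : comNzRingType) (tens R k : lmodType R[i]); field.
  by apply: S_Z; apply: S_D; exact: S_Z.
have -> : y = (p * s - q * r)^-1 *: (p *: (r *: x + s *: y) + (- r) *: (p *: x + q *: y)).
  by lin_coef (R[i] : comNzRingType) (tens R k : lmodType R[i]); field.
by apply: S_Z; apply: S_D; exact: S_Z.
Qed.

(** Eliminating the third coordinate leaves the two combinations of [w_pm_det], from which Cramer's
    rule yields two basis vectors of the block; w^+ then gives the last one, as its coefficient k -
    j is nonzero for j < k. *)
Lemma blk_span_mid j : (1 <= j <= k.-1)%N ->
  [/\ S (blk j%:Z 1 0 0), S (blk j%:Z 0 1 0) & S (blk j%:Z 0 0 1)].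
Proof.
move=> jk; have jk' : (j <= k)%N by lia.
have [] := S_w_pm jk; have := S_v jk'; rewrite !w_pmE v_E => hv hp hm.
have [h1 h2] : S (blk j%:Z 1 0 0) /\ S (blk j%:Z 0 1 0).
  have := S_D hp (S_Z (-1) hm); rewrite blkZ blkD blk_comb2 => [h1|]; last by ring.
  have := S_D hv (S_Z (b / a)%:C hp).
  rewrite blkZ blkD blk_comb2 => [h2|]; last by ring.
  apply: (span_det2 h1 h2).
  have := w_pm_det jk'; rewrite -(fmorph_eq0 (real_complex R)) -(mulrI_eq0 _ (lregP I0)).
  by congr (_ != 0); ring.
split; [exact: h1|exact: h2|].
have g0 : I * (K - j%:R)%:C != 0.
  apply: mulf_neq0; first exact: I0.
  by rewrite fmorph_eq0 subr_eq0 eqr_nat; lia.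
have -> : blk j%:Z 0 0 1 = (I * (K - j%:R)%:C)^-1 *:
  (blk j%:Z (I * (alpha a b k 1 j)%:C) (beta a b k 1 j)%:C (I * (K - j%:R)%:C)
    + (- 1) *: ((I * (alpha a b k 1 j)%:C) *: blk j%:Z 1 0 0
      + (beta a b k 1 j)%:C *: blk j%:Z 0 1 0)).
  rewrite (blk_comb _ _ _ (I * (K - j%:R)%:C)).
  move: (blk j%:Z 1 0 0) (blk j%:Z 0 1 0) (blk j%:Z 0 0 1) g0 => t0 t1 t2.
  move: (I * (K - j%:R)%:C) => g g0.
  by lin_coef (R[i] : comNzRingType) (tens R k : lmodType R[i]); field.
by apply: S_Z; apply: S_D => //; apply: S_Z; apply: S_D; exact: S_Z.
Qed.

(** Since P_(-1) = 0, this block is two-dimensional; v_0 and w_0 have determinant -i k (2 b^2/a^2 +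
    k) in it. *)
Lemma blk_span_0 : S (blk 0 0 1 0) /\ S (blk 0 0 0 1).
Proof.
have := S_v (leq0n k); have := S_w_0.
rewrite w_0E v_E blk_comb [blk _ _ _ _ in X in _ -> X]blk_comb.
rewrite rmorph0 mul0r rmorph0 mulr0 !scale0r !add0r.
move=> h1 h2; apply: (span_det2 h1 h2).
rewrite !subr0 mulr0 subr0 mulrCA -mulrA -mulrBr mulf_neq0 //.
rewrite -!rmorphM -rmorphB fmorph_eq0.
rewrite [X in X != 0](_ : _ = - (K * (2 * (b ^+ 2 / a ^+ 2) + K))); last by field.
have K_gt0 : 0 < K by rewrite ltr0n; lia.
by rewrite oppr_eq0 mulf_neq0 ?gt_eqF // addr_gt0 // mulr_gt0 // divr_gt0 ?exprn_gt0.
Qed.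

Lemma blk_span_k : S (blk k%:Z 1 0 0) /\ S (blk k%:Z 0 1 0).
Proof.
have := S_v (leqnn k); have := S_w_k.
rewrite w_kE v_E blk_comb [blk _ _ _ _ in X in _ -> X]blk_comb.
rewrite subrr mul0r oppr0 rmorph0 mulr0 !scale0r !addr0.
move=> h1 h2; apply: (span_det2 h1 h2).
rewrite [X in _ - X]mulrCA -mulrA -mulrBr mulf_neq0 //.
rewrite -!rmorphM -rmorphB fmorph_eq0.
rewrite [X in X != 0](_ : _ = - (K * (2 * (b ^+ 2 / a ^+ 2) + K))); last by field.
have K_gt0 : 0 < K by rewrite ltr0n; lia.
by rewrite oppr_eq0 mulf_neq0 ?gt_eqF // addr_gt0 // mulr_gt0 // divr_gt0 ?exprn_gt0.
Qed.

Lemma tensor_span_X1 l : (l <= k)%N -> S (tensor (Pl R k l%:Z) (dualX R 0)).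
Proof.
move=> lk; suff : S (blk l%:Z 0 1 0) by rewrite /block !scale0r scale1r add0r addr0.
have [->|l0] := eqVneq l 0%N; first by case: blk_span_0.
have [->|lk'] := eqVneq l k; first by case: blk_span_k.
by have [|] := @blk_span_mid l; first by lia.
Qed.

(** P_l with X_2 + i X_3 sits in block l + 1, so the exceptional cases are l = k (block k+1, spanned
    by [w_k1]) and l = k - 1 (block k). For X_2 - i X_3 the shift is l - 1. *)
Lemma tensor_span_X23p l : (l <= k)%N ->
  S (tensor (Pl R k l%:Z) (dualX R 1 + I *: dualX R 2)).
Proof.
move=> lk; suff : S (blk (l%:Z + 1) 1 0 0) by rewrite /block !scale0r scale1r !addr0 addrK.
have [->|lk'] := eqVneq l k; first by rewrite -w_k1E.
have -> : l%:Z + 1 = l.+1 by lia.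
have [->|lk2] := eqVneq l.+1 k; first by case: blk_span_k.
by have [|] := @blk_span_mid l.+1; first by lia.
Qed.

Lemma tensor_span_X23m l : (l <= k)%N ->
  S (tensor (Pl R k l%:Z) (dualX R 1 - I *: dualX R 2)).
Proof.
move=> lk; suff : S (blk (l%:Z - 1) 0 0 1) by rewrite /block !scale0r scale1r !add0r subrK.
case: l lk => [|l] lk; first by rewrite sub0r -w_m1E.
have -> : l.+1%:Z - 1 = l by lia.
have [->|l0] := eqVneq l 0%N; first by case: blk_span_0.
by have [|] := @blk_span_mid l; first by lia.
Qed.

Lemma tensor_span (xi : 'rV[R[i]]_3) (Q : Vk R k) :
  (forall l, (l <= k)%N -> S (tensor (Pl R k l%:Z) xi)) -> S (tensor Q xi).
Proof.
move=> h.
have -> : tensor Q xi = \sum_(l < k.+1)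
    mcoeff (mexp k l) (mpoly_of_dhomog Q) *: tensor (Pl R k l%:Z) xi.
  apply/ffunP => i; rewrite ffunE sum_ffunE {1}(Vk_decomp Q) scaler_sumr.
  by apply: eq_bigr => l _; rewrite !ffunE !scalerA mulrC.
(* [S] contains 0 as a zero multiple of one of its given members. *)
elim/big_ind: _ => // [|l _]; first by have := S_Z 0 S_w_m1; rewrite scale0r.
by apply: S_Z; apply: h; rewrite -ltnS.
Qed.

Lemma tens_span (t : tens R k) : S t.
Proof.
(* Change of coframe from X_2, X_3 to X_2 + i X_3 and X_2 - i X_3. *)
have -> : t = tensor (t 0) (dualX R 0)
    + tensor (2^-1 *: (t 1 - I *: t 2)) (dualX R 1 + I *: dualX R 2)
    + tensor (2^-1 *: (t 1 + I *: t 2)) (dualX R 1 - I *: dualX R 2).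
  apply/ffunP; elim/ord3_ind; rewrite !ffunE !mxE /=.
  - move: (t 0) (t 1) (t 2) => t0 t1 t2.
    by lin_coef (R[i] : comNzRingType) (Vk R k : lmodType R[i]); field.
  - move: (t 0) (t 1) (t 2) => t0 t1 t2.
    by lin_coef (R[i] : comNzRingType) (Vk R k : lmodType R[i]); field.
  - move: (t 0) (t 1) (t 2) => t0 t1 t2.
    by lin_coef (R[i] : comNzRingType) (Vk R k : lmodType R[i]); field: (mulii R).
apply: S_D; first apply: S_D; apply: tensor_span.
- exact: tensor_span_X1.
- exact: tensor_span_X23p.
- exact: tensor_span_X23m.
Qed.

End Span.

Local Notation U := (<<eigenvectors a b k>>%VS).

Lemma v_span j : (j <= k)%N -> v_ a b k j \in U.
Proof.
move=> jk; apply: memv_span; rewrite mem_cat; apply/orP; left.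
by apply: map_f; rewrite mem_iota.
Qed.

Lemma w_span : {subset [:: w_m1 R k; w_0 a b k; w_k a b k; w_k1 R k] <= U}.
Proof.
by move=> w hw; apply: memv_span; rewrite /eigenvectors mem_cat (mem_cat _ _ (_ ++ _)) hw orbT.
Qed.

Lemma w_pm_span j : (1 <= j <= k.-1)%N -> w_pm a b k 1 j \in U /\ w_pm a b k (-1) j \in U.
Proof.
move=> jk; have ji : j \in iota 1 k.-1 by rewrite mem_iota; lia.
split; apply: memv_span; rewrite /eigenvectors !mem_cat; apply/or4P.
  by apply: Or43; exact: (map_f _ ji).
by apply: Or44; exact: (map_f _ ji).
Qed.

Lemma eigenvectors_basis : basis_of fullv (eigenvectors a b k).
Proof.
rewrite basisEdim; apply/andP; split.
  have [m1 m2 m3 m4] := mem_seq4 (w_m1 R k) (w_0 a b k) (w_k a b k) (w_k1 R k).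
  apply/subvP => t _; apply: (tens_span (S := fun t => t \in U)).
  - by move=> z u; exact: memvZ.
  - by move=> u v; exact: memvD.
  - exact: v_span.
  - exact: w_span m1.
  - exact: w_span m2.
  - exact: w_span m3.
  - exact: w_span m4.
  - exact: w_pm_span.
rewrite dimvf.
have -> : dim (tens R k) = (3 * k.+1)%N.
  (* Three copies of V_k, whose dimension counts the monomials of degree k in two variables. *)
  rewrite -[LHS]/(#|'I_3| * 'C(k + 1, k))%N card_ord addn1.
  by rewrite -bin_sub // subSnn bin1.
by rewrite /eigenvectors !size_cat !size_map !size_iota /=; lia.
Qed.

End Basis.

Theorem theorem4p1 (R : realType) (a b : R) (k : nat)
    (phi : 'Hom(Vk R k, 'Hom(Vk R k, R[i]^o))) :
  0 < a -> 0 < b -> (2 <= k)%N -> equivariant_iso phi ->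
  let D := Delta1_tens a b b phi in
  [/\ basis_of fullv (eigenvectors a b k),
      forall j : nat, (j <= k)%N -> D (v_ a b k j) = (nu a b k j)%:C *: v_ a b k j,
      D (w_m1 R k) = (mu_m1 a k)%:C *: w_m1 R k
      /\ D (w_k1 R k) = (mu_m1 a k)%:C *: w_k1 R k,
      D (w_0 a b k) = (mu_0 a b k)%:C *: w_0 a b k
      /\ D (w_k a b k) = (mu_0 a b k)%:C *: w_k a b k
    & forall j : nat, (1 <= j <= k.-1)%N ->
      D (w_pm a b k 1 j) = (mu_pm a b k 1 j)%:C *: w_pm a b k 1 j
      /\ D (w_pm a b k (-1) j) = (mu_pm a b k (-1) j)%:C *: w_pm a b k (-1) j].
Proof.
move=> a_gt0 b_gt0 k_ge2 [phi_bij equivariant] D.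
have a0 : a != 0 by rewrite gt_eqF.
have b0 : b != 0 by rewrite gt_eqF.
(* [Dt] does not involve [phi]: the choice of the isomorphism disappears here. *)
have DE t : D t = Dt a b b t := Delta1_tensE a0 b0 b0 equivariant phi_bij t.
split.
- exact: eigenvectors_basis.
- by move=> j jk; rewrite DE Dt_v.
- by split; rewrite DE; [exact: Dt_w_m1|exact: Dt_w_k1].
- by split; rewrite DE; [exact: Dt_w_0|exact: Dt_w_k].
- by move=> j jk; split; rewrite DE; apply: Dt_w_pm; rewrite ?sqrrN ?expr1n.
Qed.
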